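(* Let $\mathcal H$ be a finite-dimensional Hilbert space and let $(\mathcal F_n)_{n\ge1}$, $\mathcal F_n\subseteq\mathcal D(\mathcal H^{\otimes n})$, satisfy: (1) each $\mathcal F_n$ is convex and closed; (2) $\mathcal F_1$ contains a full-rank state; (3) if $\sigma\in\mathcal F_{n+1}$ then $\mathrm{Tr}_{n+1}\sigma\in\mathcal F_n$; (4) if $\sigma\in\mathcal F_n$, $\sigma'\in\mathcal F_m$ then $\sigma\otimes\sigma'\in\mathcal F_{n+m}$; (5) each $\mathcal F_n$ is invariant under conjugation by the unitaries permuting the $n$ subsystems. Assume moreover that for some numbers $r_n\in(0,1]$ the following compatibility condition holds: for all $n,m\ge1$, every Hermitian operator $X$ on $\mathcal H^{\otimes n}$ with $\|X\|_\infty\le r_n$, every sign $\pm$, and every $\sigma\in\mathcal F_{n+m}$, \[ \mathrm{Tr}_{1\ldots n}\Big[\Big(\tfrac{\mathbb 1^{\otimes n}\pm X}{2}\otimes\mathbb 1^{\otimes m}\Big)\sigma\Big]\in\mathrm{cone}(\mathcal F_m). \] Then for all $\rho\in\mathcal D(\mathcal H)$ and all $\varepsilon\in(0,1)$, \[ \lim_{n\to\infty}\frac1nD_H^\varepsilon(\mathcal F_n\|\rho^{\otimes n})=D(\mathcal F\|\rho):=\min_{\sigma\in\mathcal F_1}D(\sigma\|\rho), \] and in particular $\mathrm{Sanov}(\rho\|\mathcal F)=D(\mathcal F\|\rho)$.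
   Context: $\mathrm{cone}(\mathcal F_m)=\{\lambda\sigma:\lambda\ge0,\ \sigma\in\mathcal F_m\}$; $\mathrm{Tr}_{1\ldots n}$ is the partial trace over the first $n$ subsystems; $\|\cdot\|_\infty$ is the operator norm. $D(\sigma\|\rho)=\mathrm{Tr}\,\sigma(\log\sigma-\log\rho)$ is the Umegaki relative entropy. $D_H^\varepsilon(\sigma\|\rho)=-\log\min\{\mathrm{Tr}M\rho:0\le M\le\mathbb 1,\ \mathrm{Tr}(\mathbb 1-M)\sigma\le\varepsilon\}$, $D_H^\varepsilon(\mathcal F_n\|\omega)=\inf_{\sigma\in\mathcal F_n}D_H^\varepsilon(\sigma\|\omega)$, and $\mathrm{Sanov}(\rho\|\mathcal F)=\lim_{\varepsilon\to0^+}\liminf_{n\to\infty}\frac1nD_H^\varepsilon(\mathcal F_n\|\rho^{\otimes n})$. *)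

(* Defs.v *)
From HB Require Import structures.
From mathcomp Require Import all_boot all_order all_algebra all_fingroup.
From mathcomp Require Import all_classical all_reals all_analysis.
From mathcomp Require Import complex mxtens.
Set Implicit Arguments.
Unset Strict Implicit.
Unset Printing Implicit Defensive.
Import Order.TTheory GRing.Theory Num.Theory Num.Def.
Import numFieldNormedType.Exports.

Local Open Scope ring_scope.
Local Open Scope classical_set_scope.

Section QInfo.
Variable R : realType.
Local Notation C := (R[i]).

Definition adj m n (A : 'M[C]_(m, n)) : 'M[C]_(n, m) := (map_mx conjC A)^T.

Definition psdmx k (A : 'M[C]_k) : Prop :=
  A \is hermsymmx /\ forall v : 'cV[C]_k, 0 <= (adj v *m A *m v) 0 0.

Definition density k (A : 'M[C]_k) : Prop := psdmx A /\ \tr A = 1.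

Definition full_rank k (A : 'M[C]_k) : Prop := \rank A = k.

Definition vnorm k (v : 'cV[C]_k) : R := Num.sqrt (complex.Re ((adj v *m v) 0 0)).
Definition opnorm k (X : 'M[C]_k) : R :=
  sup [set r | exists v : 'cV[C]_k, vnorm v <= 1 /\ r = vnorm (X *m v)].

(** closedness of a set of matrices (w.r.t. the usual (entrywise) topology,
    stated sequentially, which is equivalent in finite dimension) *)
Definition mx_closed k (S : set 'M[C]_k) : Prop :=
  forall (u : nat -> 'M[C]_k) (A : 'M[C]_k),
    (forall n, S (u n)) ->
    (forall i j, (fun n => complex.Re (u n i j)) @ \oo --> (complex.Re (A i j) : R)) ->
    (forall i j, (fun n => complex.Im (u n i j)) @ \oo --> (complex.Im (A i j) : R)) ->
    S A.

Definition mx_convex k (S : set 'M[C]_k) : Prop :=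
  forall A B : 'M[C]_k, S A -> S B -> forall t : R, 0 <= t <= 1 ->
    S ((t%:C)%C *: A + ((1 - t)%:C)%C *: B).

Definition mx_cone k (S : set 'M[C]_k) : set 'M[C]_k :=
  [set A | exists2 l : R, 0 <= l & exists2 s, S s & A = (l%:C)%C *: s].

(** partial traces on C^a (x) C^b, with index convention of [tensmx]
    (the first factor is the most significant digit) *)
Definition ptrace_last a b (A : 'M[C]_(a * b)) : 'M[C]_a :=
  \matrix_(i, j) \sum_(k < b) A (mxtens_index (i, k)) (mxtens_index (j, k)).
Definition ptrace_first a b (A : 'M[C]_(a * b)) : 'M[C]_b :=
  \matrix_(k, l) \sum_(i < a) A (mxtens_index (i, k)) (mxtens_index (i, l)).

Variable d : nat.

Definition tens n m (A : 'M[C]_(d ^ n)) (B : 'M[C]_(d ^ m)) : 'M[C]_(d ^ (n + m)) :=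
  castmx (esym (expnD d n m), esym (expnD d n m)) (tensmx A B).

Definition trace_last n (A : 'M[C]_(d ^ n.+1)) : 'M[C]_(d ^ n) :=
  ptrace_last (castmx (expnSr d n, expnSr d n) A).

Definition trace_firsts n m (A : 'M[C]_(d ^ (n + m))) : 'M[C]_(d ^ m) :=
  ptrace_first (castmx (expnD d n m, expnD d n m) A).

(** k-th tensor digit (0-based subsystem k) of a basis index of H^{(x)n} *)
Definition digit n (i : 'I_(d ^ n)) (k : 'I_n) : nat := (i %/ d ^ (n.-1 - k)) %% d.

Definition perm_op n (pi : 'S_n) : 'M[C]_(d ^ n) :=
  \matrix_(i, j) ([forall k : 'I_n, digit i (pi k) == digit j k])%:R.

Definition tpow (rho : 'M[C]_d) n : 'M[C]_(d ^ n) := ntensmx rho n.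

Definition mxfun k (f : R -> R) (A : 'M[C]_k) : 'M[C]_k :=
  invmx (spectralmx A) *m
  diag_mx (map_mx (fun x : C => ((f (complex.Re x))%:C)%C) (spectral_diag A)) *m
  spectralmx A.

Definition relent k (sigma rho : 'M[C]_k) : \bar R :=
  if `[< forall v : 'cV[C]_k, rho *m v = 0 -> sigma *m v = 0 >]
  then (complex.Re (\tr (sigma *m (mxfun (@ln R) sigma - mxfun (@ln R) rho))))%:E
  else +oo%E.

Definition hyptest_min k (eps : R) (sigma rho : 'M[C]_k) : R :=
  inf [set t | exists M : 'M[C]_k,
        [/\ psdmx M, psdmx (1%:M - M),
            complex.Re (\tr ((1%:M - M) *m sigma)) <= eps &
            t = complex.Re (\tr (M *m rho))]].

Definition DH k (eps : R) (sigma rho : 'M[C]_k) : \bar R :=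
  let b := hyptest_min eps sigma rho in
  if b == 0 then +oo%E else (- ln b)%:E.

Definition DH_set k (eps : R) (F : set 'M[C]_k) (omega : 'M[C]_k) : \bar R :=
  ereal_inf [set DH eps s omega | s in F].

Definition rate (F : forall n, set 'M[C]_(d ^ n)) (rho : 'M[C]_d) (eps : R) n
  : \bar R := ((n%:R)^-1)%:E * DH_set eps (F n) (tpow rho n).

Definition Sanov (F : forall n, set 'M[C]_(d ^ n)) (rho : 'M[C]_d) : \bar R :=
  lim ((fun eps => limn_einf (rate F rho eps)) @ 0^'+).

Definition relent_set (F1 : set 'M[C]_(d ^ 1)) (rho : 'M[C]_d) : \bar R :=
  ereal_inf [set relent s rho | s in F1].

End QInfo.

(* Main.v *)
(** Upper bound. For [s] in [F_1] the powers of [s] lie in [F_n]. If [P1] and [P2] are the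
    typical projections of the powers of [s] and of [rho] for the weak law of large numbers
    under [s], the inequality [M <= 2 P2 M P2 + 2 (1 - P2) M (1 - P2)] gives
    [tr M s^n <= 2 exp (n (D(s|rho) + o(1))) tr M rho^n + o(1)] for every test [M], which is
    the strong converse at every level [eps < 1].

    Lower bound. Let [s] be in [F_n] and let [t] be the average of its one-site marginals,
    which is in [F_1]. If the empirical averages of one-site observables have small variance
    under [s], the test [P2 P1 P2], built as above from eigenvectors of [t] and of [rho], is
    passed by [s] up to a small error, while [rho^n] passes it with probability
    [exp (- n (D(t|rho) - o(1)))]: only second moments of [s] enter. If the average of some [B]
    has a large variance, some site has a large covariance with that average. Permute this
    site to the front and apply the effects [(1 + X)/2] and [(1 - X)/2] with [X] proportional
    to [B]: by compatibility the conditional states of the other sites lie in [F_(n-1)], and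
    the mean purity of their average marginals exceeds that of [t] by a fixed amount. Since a
    purity is at most 1, a number of conditioning steps that does not depend on [n] suffices.

    Logarithms are regularized throughout the lower bound; Klein's inequality and the
    compactness of [F_1] remove the regularization. *)
Require Import Defs.
From HB Require Import structures.
From mathcomp Require Import all_boot all_order all_algebra all_fingroup.
From mathcomp Require Import all_classical all_reals all_analysis.
From mathcomp Require Import complex mxtens.
From mathcomp Require Import ring lra zify.
Import Order.TTheory GRing.Theory Num.Theory Num.Def.
Import numFieldNormedType.Exports.
Local Open Scope ring_scope.
Local Open Scope classical_set_scope.

Set Implicit Arguments.
Unset Strict Implicit.
Unset Printing Implicit Defensive.

(** * Positive matrices and spectral decompositions *)

Section Psd.
Variable R : realType.
Local Notation C := (R[i]).

(** All quantities are kept real by taking real parts at once; for products of two Hermitian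
    matrices nothing is lost, see [tr_hermM]. *)
Definition rtr k (A : 'M[C]_k) : R := complex.Re (\tr A).

Lemma conjCE (z : C) : conjC z = (complex.Re z -i* complex.Im z)%C.
Proof. by case: z. Qed.

Lemma conjC_real (a : R) : conjC ((a%:C)%C : C) = (a%:C)%C.
Proof. by apply/eqP; rewrite eq_complex /= oppr0 !eqxx. Qed.

Lemma ReD (x y : C) : complex.Re (x + y) = complex.Re x + complex.Re y.
Proof. by case: x; case: y. Qed.

Lemma ReN (x : C) : complex.Re (- x) = - complex.Re x.
Proof. by case: x. Qed.

Lemma ReZ (a : R) (x : C) : complex.Re ((a%:C)%C * x) = a * complex.Re x.
Proof. by case: x => u v /=; rewrite mul0r subr0. Qed.

Lemma adjE m n (A : 'M[C]_(m, n)) i j : adj A i j = conjC (A j i).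
Proof. by rewrite !mxE. Qed.

Lemma adjK m n (A : 'M[C]_(m, n)) : adj (adj A) = A.
Proof. by apply/matrixP => i j; rewrite !adjE conjCK. Qed.

Lemma adjM m n p (A : 'M[C]_(m, n)) (B : 'M[C]_(n, p)) :
  adj (A *m B) = adj B *m adj A.
Proof. by rewrite /adj map_mxM trmx_mul. Qed.

Lemma adjD m n (A B : 'M[C]_(m, n)) : adj (A + B) = adj A + adj B.
Proof. by apply/matrixP => i j; rewrite !mxE rmorphD. Qed.

Lemma adjB m n (A B : 'M[C]_(m, n)) : adj (A - B) = adj A - adj B.
Proof. by apply/matrixP => i j; rewrite !mxE rmorphB. Qed.

Lemma adjN m n (A : 'M[C]_(m, n)) : adj (- A) = - adj A.
Proof. by apply/matrixP => i j; rewrite !mxE rmorphN. Qed.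

Lemma adjZ m n (a : R) (A : 'M[C]_(m, n)) : adj ((a%:C)%C *: A) = (a%:C)%C *: adj A.
Proof. by apply/matrixP => i j; rewrite !mxE rmorphM; congr (_ * _); exact: conjC_real. Qed.

Lemma adj1 n : adj (1%:M : 'M[C]_n) = 1%:M.
Proof. by apply/matrixP => i j; rewrite !mxE eq_sym; case: eqP => _; rewrite ?rmorph1 ?rmorph0. Qed.

Lemma adj_hermP k (A : 'M[C]_k) : reflect (adj A = A) (A \is hermsymmx).
Proof.
apply: (iffP (is_hermitianmxP _ _ _)); rewrite /= expr0 scale1r => h.
  by rewrite [in RHS]h /adj map_trmx.
by rewrite -[in LHS]h /adj map_trmx.
Qed.

Lemma rtrD k (A B : 'M[C]_k) : rtr (A + B) = rtr A + rtr B.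
Proof. by rewrite /rtr mxtraceD ReD. Qed.

Lemma rtrN k (A : 'M[C]_k) : rtr (- A) = - rtr A.
Proof. by rewrite /rtr raddfN /= ReN. Qed.

Lemma rtrB k (A B : 'M[C]_k) : rtr (A - B) = rtr A - rtr B.
Proof. by rewrite rtrD rtrN. Qed.

Lemma rtrZ k (a : R) (A : 'M[C]_k) : rtr ((a%:C)%C *: A) = a * rtr A.
Proof. by rewrite /rtr mxtraceZ ReZ. Qed.

Lemma rtrC m n (A : 'M[C]_(m, n)) (B : 'M[C]_(n, m)) : rtr (A *m B) = rtr (B *m A).
Proof. by rewrite /rtr mxtrace_mulC. Qed.

Lemma rtr_compressC k (A B D : 'M[C]_k) :
  rtr (A *m B *m A *m D) = rtr (B *m (A *m D *m A)).
Proof. by rewrite -[LHS]/(rtr _) -!mulmxA rtrC !mulmxA. Qed.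

Lemma Re_ge0 (z : C) : 0 <= z -> 0 <= complex.Re z.
Proof. by case: z => a b; rewrite lecE /= => /andP[]. Qed.

Lemma gram_diag_ge0 m n (Q : 'M[C]_(m, n)) i : 0 <= (adj Q *m Q) i i.
Proof.
rewrite mxE; apply: sumr_ge0 => j _; rewrite adjE mulrC; exact: mul_conjC_ge0.
Qed.

Lemma rtr_gram_ge0 m n (Q : 'M[C]_(m, n)) : 0 <= rtr (adj Q *m Q).
Proof.
rewrite /rtr raddf_sum; apply: sumr_ge0 => i _; exact/Re_ge0/gram_diag_ge0.
Qed.

Lemma psd_gram m n (Q : 'M[C]_(m, n)) : psdmx (adj Q *m Q).
Proof.
split; first by apply/adj_hermP; rewrite adjM adjK.
move=> v; rewrite mulmxA -adjM -mulmxA; exact: gram_diag_ge0.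
Qed.

Lemma psd_herm k (A : 'M[C]_k) : psdmx A -> adj A = A.
Proof. by case=> /adj_hermP. Qed.

(* [sp W h] is the operator with eigenvalues [h] in the orthonormal basis given
   by the rows of the unitary [W]. *)
Definition sp k (W : 'M[C]_k) (h : 'I_k -> R) : 'M[C]_k :=
  adj W *m diag_mx (\row_i (h i)%:C%C) *m W.

Definition unit_mx k (W : 'M[C]_k) := W *m adj W = 1%:M.

Lemma unit_mxV k (W : 'M[C]_k) : unit_mx W -> adj W *m W = 1%:M.
Proof. by move/mulmx1C. Qed.

Lemma spM k (W : 'M[C]_k) g h : unit_mx W ->
  sp W g *m sp W h = sp W (fun i => g i * h i).
Proof.
move=> uW; rewrite /sp !mulmxA; congr (_ *m _).
rewrite -!mulmxA; congr (_ *m _).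
rewrite [W *m _]mulmxA uW mul1mx; apply/matrixP => i j.
rewrite mul_diag_mx !mxE; case: (i == j); rewrite ?mulr0n ?mulr0 // !mulr1n.
by rewrite -rmorphM.
Qed.

Lemma sp1 k (W : 'M[C]_k) : unit_mx W -> sp W (fun=> 1) = 1%:M.
Proof.
move=> uW; rewrite /sp (_ : diag_mx _ = 1%:M) ?mulmx1 ?unit_mxV //.
by apply/matrixP => i j; rewrite !mxE.
Qed.

Lemma eq_sp k (W : 'M[C]_k) g h : g =1 h -> sp W g = sp W h.
Proof. by move=> e; rewrite /sp; congr (_ *m diag_mx _ *m _); apply/rowP => i; rewrite !mxE e. Qed.

Lemma spD k (W : 'M[C]_k) g h : sp W g + sp W h = sp W (fun i => g i + h i).
Proof.
rewrite /sp -mulmxDl -mulmxDr; congr (_ *m _ *m _).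
by apply/matrixP => i j; rewrite !mxE -mulrnDl -rmorphD.
Qed.

Lemma spZ k (W : 'M[C]_k) (a : R) g : (a%:C)%C *: sp W g = sp W (fun i => a * g i).
Proof.
rewrite /sp scalemxAl scalemxAr; congr (_ *m _ *m _).
by apply/matrixP => i j; rewrite !mxE rmorphM /= mulrnAr.
Qed.

Lemma spB k (W : 'M[C]_k) g h : sp W g - sp W h = sp W (fun i => g i - h i).
Proof.
rewrite /sp -mulmxBl -mulmxBr; congr (_ *m _ *m _).
by apply/matrixP => i j; rewrite !mxE -mulrnBl -rmorphB.
Qed.

Lemma adj_sp k (W : 'M[C]_k) g : adj (sp W g) = sp W g.
Proof.
rewrite /sp !adjM adjK mulmxA; congr (_ *m _ *m _).
apply/matrixP => i j; rewrite !mxE eq_sym; case: eqP => [->|_]; last by rewrite !mulr0n rmorph0.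
by rewrite !mulr1n conjC_real.
Qed.

(* The diagonal entries of [s] in the basis of the rows of [W]. *)
Definition wt k (W s : 'M[C]_k) (i : 'I_k) : R := complex.Re ((W *m s *m adj W) i i).

(** The bridge to probability: measuring [s] in the basis [W] turns a quantum expectation into a
    classical weighted sum, and the later estimates are made on such sums. *)
Lemma rtr_sp k (W s : 'M[C]_k) h : rtr (s *m sp W h) = \sum_i wt W s i * h i.
Proof.
rewrite /sp mulmxA rtrC !mulmxA /rtr raddf_sum; apply: eq_bigr => i _.
rewrite mul_mx_diag mxE [X in _ * X]mxE /wt.
by rewrite mulrC; apply: etrans (ReZ _ _) (mulrC _ _).
Qed.

Lemma wt_ge0 k (W s : 'M[C]_k) i : psdmx s -> 0 <= wt W s i.
Proof.
case=> _ /(_ (adj W *m delta_mx i 0)) h; apply: Re_ge0; move: h.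
rewrite adjM adjK.
rewrite (_ : adj (delta_mx i 0) = delta_mx 0 i); last first.
  by apply/matrixP => a b; rewrite !mxE andbC; case: (_ && _); rewrite ?rmorph1 ?rmorph0.
by rewrite -!mulmxA -rowE mxE !mulmxA -colE mxE.
Qed.

Lemma sum_wt k (W s : 'M[C]_k) : unit_mx W -> \sum_i wt W s i = rtr s.
Proof.
move=> uW; rewrite -[RHS](congr1 (@rtr k) (mulmx1 s)) -(sp1 uW) rtr_sp.
by apply: eq_bigr => i _; rewrite mulr1.
Qed.

Lemma wt_sp k (W : 'M[C]_k) h i : unit_mx W -> wt W (sp W h) i = h i.
Proof.
move=> uW; rewrite /wt /sp !mulmxA uW mul1mx -!mulmxA uW mulmx1 !mxE eqxx.
by rewrite mulr1n.
Qed.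

Lemma psd_sp k (W : 'M[C]_k) h : (forall i, 0 <= h i) -> psdmx (sp W h).
Proof.
move=> h0; pose Q := diag_mx (\row_i ((Num.sqrt (h i))%:C)%C) *m W.
suff -> : sp W h = adj Q *m Q by exact: psd_gram.
rewrite /Q adjM /sp !mulmxA; congr (_ *m _); rewrite -!mulmxA; congr (_ *m _).
apply/matrixP => i j; rewrite mul_mx_diag !mxE; case: eqP => [->|] ; last first.
  rewrite eq_sym => /eqP/negbTE ->; by rewrite !mulr0n rmorph0 mul0r.
rewrite eqxx !mulr1n conjC_real -rmorphM -expr2 sqr_sqrtr //.
Qed.

Lemma rtr_sp0 k (W : 'M[C]_k) h : unit_mx W -> rtr (sp W h) = \sum_i h i.
Proof. by move=> uW; rewrite -(sum_wt _ uW); apply: eq_bigr => i _; rewrite wt_sp. Qed.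

Definition eig k (A : 'M[C]_k) (i : 'I_k) : R := complex.Re (spectral_diag A 0 i).

(** Brings the library's spectral theorem, and the functional calculus [mxfun] occurring in the
    relative entropy, into the form [sp]. *)
Lemma herm_spectral k (A : 'M[C]_k) : adj A = A ->
  [/\ unit_mx (spectralmx A), A = sp (spectralmx A) (eig A) &
      forall f, mxfun f A = sp (spectralmx A) (fun i => f (eig A i))].
Proof.
move=> /adj_hermP hA; set W := spectralmx A.
have uW : W \is unitarymx by exact: spectral_unitarymx.
have uW' : unit_mx W.
  by move/unitarymxP: (uW); rewrite /unit_mx /adj map_trmx.
have iW : invmx W = adj W by rewrite invmx_unitary // /adj map_trmx.
split; [exact: uW'| |].
  have /orthomx_spectralP {1}-> := hermitian_normalmx hA.
  rewrite -/W iW /sp; congr (_ *m diag_mx _ *m _); apply/rowP => i; rewrite !mxE /eig.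
  have /mxOverP /(_ 0 i) := hermitian_spectral_diag_real hA.
  by move/complex_realP => [x ->].
move=> f; rewrite /mxfun -/W iW /sp; congr (_ *m diag_mx _ *m _).
by apply/rowP => i; rewrite !mxE.
Qed.

Lemma psd_spectral k (A : 'M[C]_k) : psdmx A ->
  exists W h, [/\ unit_mx W, A = sp W h & forall i, 0 <= h i].
Proof.
move=> pA; have [] := herm_spectral (psd_herm pA).
move: (spectralmx A) (eig A) => W h uW eA _.
exists W, h; split=> // i; rewrite eA in pA.
by have := wt_ge0 W i pA; rewrite wt_sp.
Qed.

Lemma psdP k (A : 'M[C]_k) : psdmx A -> exists Q : 'M[C]_k, A = adj Q *m Q.
Proof.
case/psd_spectral => W [h [uW -> h0]].
exists (sp W (fun i => Num.sqrt (h i))).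
by rewrite adj_sp spM //; apply: eq_sp => i; rewrite -expr2 sqr_sqrtr.
Qed.

Lemma psdD k (A B : 'M[C]_k) : psdmx A -> psdmx B -> psdmx (A + B).
Proof.
move=> pA pB; split; first by apply/adj_hermP; rewrite adjD !psd_herm.
by move=> v; rewrite mulmxDr mulmxDl mxE addr_ge0 //; [case: pA|case: pB].
Qed.

Lemma psdJ m n (T : 'M[C]_(m, n)) (A : 'M[C]_m) : psdmx A -> psdmx (adj T *m A *m T).
Proof. by case/psdP => Q ->; rewrite !mulmxA -adjM -mulmxA; exact: psd_gram. Qed.

Lemma rtr_psd_ge0 k (A : 'M[C]_k) : psdmx A -> 0 <= rtr A.
Proof. by case/psdP => Q ->; exact: rtr_gram_ge0. Qed.

Lemma rtr_psdM_ge0 k (A B : 'M[C]_k) : psdmx A -> psdmx B -> 0 <= rtr (A *m B).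
Proof.
move=> /psdP[Q ->] pB; rewrite -mulmxA rtrC.
by have := rtr_psd_ge0 (psdJ (adj Q) pB); rewrite adjK.
Qed.

Lemma psd1 k : psdmx (1%:M : 'M[C]_k).
Proof. by have := psd_gram (1%:M : 'M[C]_k); rewrite adj1 mulmx1. Qed.

Lemma psdZ k (a : R) (A : 'M[C]_k) : 0 <= a -> psdmx A -> psdmx ((a%:C)%C *: A).
Proof.
move=> a0 /psd_spectral[W [h [uW -> h0]]]; rewrite spZ.
by apply: psd_sp => i; rewrite mulr_ge0.
Qed.

Lemma psd0 k : psdmx (0 : 'M[C]_k).
Proof. by have := psdZ (lexx 0) (psd1 k); rewrite scale0r. Qed.

Lemma le_rtr k (A B N : 'M[C]_k) : psdmx (B - A) -> psdmx N -> rtr (A *m N) <= rtr (B *m N).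
Proof.
by move=> pBA pN; rewrite -subr_ge0 -rtrB -mulmxBl; exact: rtr_psdM_ge0.
Qed.

Definition test k (M : 'M[C]_k) := psdmx M /\ psdmx (1%:M - M).

Lemma test_sp k (W : 'M[C]_k) h : unit_mx W -> (forall i, 0 <= h i <= 1) -> test (sp W h).
Proof.
move=> uW h01; split; first by apply: psd_sp => i; case/andP: (h01 i).
by rewrite -(sp1 uW) spB; apply: psd_sp => i; case/andP: (h01 i); rewrite subr_ge0.
Qed.

Lemma spb_idem k (W : 'M[C]_k) (p : pred 'I_k) : unit_mx W ->
  sp W (fun x => (p x)%:R) *m sp W (fun x => (p x)%:R) = sp W (fun x => (p x)%:R).
Proof. by move=> uW; rewrite spM //; apply: eq_sp => x; case: (p x); rewrite ?mulr1 ?mulr0. Qed.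

Lemma spbC k (W : 'M[C]_k) (p : pred 'I_k) : unit_mx W ->
  sp W (fun x => (p x)%:R) = 1%:M - sp W (fun x => (~~ p x)%:R).
Proof.
move=> uW; rewrite -(sp1 uW) spB; apply: eq_sp => x.
by case: (p x); rewrite ?subr0 ?subrr.
Qed.

Lemma test_spb k (W : 'M[C]_k) (p : pred 'I_k) : unit_mx W -> test (sp W (fun x => (p x)%:R)).
Proof. by move=> uW; apply: test_sp => // x; case: (p x); rewrite ?lexx ler01. Qed.

Lemma testJ k (T M : 'M[C]_k) : test (adj T *m T) -> test M -> test (adj T *m M *m T).
Proof.
case=> _ h [pM pM']; split; first exact: psdJ.
have -> : 1%:M - adj T *m M *m T = (1%:M - adj T *m T) + adj T *m (1%:M - M) *m T.
  by rewrite mulmxBr mulmx1 mulmxBl addrA subrK.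
exact: (psdD h (psdJ T pM')).
Qed.

(* The difference of the two sides is [(A - B) M (A - B)]. *)
Lemma pinching k (A B M : 'M[C]_k) : adj A = A -> adj B = B -> psdmx M ->
  psdmx ((A *m M *m A) *+ 2 + (B *m M *m B) *+ 2 - (A + B) *m M *m (A + B)).
Proof.
move=> hA hB pM; have := psdJ (A - B) pM.
rewrite !adjB hA hB; congr psdmx.
rewrite !mulmxBl !mulmxBr !mulmxDl !mulmxDr.
move: (A *m M *m A) (A *m M *m B) (B *m M *m A) (B *m M *m B) => a b c e.
by apply/matrixP => i j; rewrite mulr2n !mxE; ring.
Qed.

Lemma rtr_pinching k (A B M s : 'M[C]_k) : adj A = A -> adj B = B -> psdmx M -> psdmx s ->
  rtr ((A + B) *m M *m (A + B) *m s) <= rtr (A *m M *m A *m s) *+ 2 + rtr (B *m M *m B *m s) *+ 2.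
Proof.
move=> hA hB pM ps; have := le_rtr (pinching hA hB pM) ps.
by rewrite !mulr2n !mulmxDl !rtrD.
Qed.

Lemma rtr_conj_test k (Q N s : 'M[C]_k) : adj Q = Q -> test N -> psdmx s ->
  rtr (Q *m N *m Q *m s) <= rtr (Q *m Q *m s).
Proof.
move=> hQ [_ pN] ps; have := psdJ Q pN; rewrite hQ mulmxBr mulmx1 mulmxBl => h.
exact: (le_rtr h ps).
Qed.

Lemma rtr_test_ge0 k (M s : 'M[C]_k) : test M -> psdmx s -> 0 <= rtr (M *m s).
Proof. by case=> pM _ ps; exact: rtr_psdM_ge0. Qed.

Lemma rtr_sp_mul k (W s : 'M[C]_k) h : rtr (sp W h *m s) = \sum_i wt W s i * h i.
Proof. by rewrite rtrC rtr_sp. Qed.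

Lemma density_rtr k (s : 'M[C]_k) : density s -> rtr s = 1.
Proof. by case=> _ e; rewrite /rtr e. Qed.

Lemma density_wt k (W s : 'M[C]_k) : unit_mx W -> density s ->
  (forall i, 0 <= wt W s i) /\ \sum_i wt W s i = 1.
Proof.
move=> uW ds; split; last by rewrite sum_wt // density_rtr.
by move=> i; apply: wt_ge0; case: ds.
Qed.

(** Conjugating the trace reverses the product of the adjoints, and cyclicity restores the order, so
    the trace is real. *)
Lemma tr_hermM k (A B : 'M[C]_k) : adj A = A -> adj B = B ->
  \tr (A *m B) = ((rtr (A *m B))%:C)%C.
Proof.
move=> hA hB; have : conjC (\tr (A *m B)) = \tr (A *m B).
  rewrite [in RHS]mxtrace_mulC -[in RHS]hA -[in RHS]hB -adjM /mxtrace rmorph_sum.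
  by apply: eq_bigr => i _; rewrite adjE.
rewrite /rtr; case: (\tr _) => x y /eqP; rewrite conjCE eq_complex /= => /andP[_ /eqP e].
by congr (_ +i* _)%C; lra.
Qed.

Lemma test1 k : test (1%:M : 'M[C]_k).
Proof. by split; [exact: psd1|rewrite subrr; exact: psd0]. Qed.

Lemma rtr_conjC k (P A B : 'M[C]_k) :
  rtr (adj P *m A *m P *m B) = rtr (A *m (P *m B *m adj P)).
Proof. by rewrite -!mulmxA rtrC !mulmxA. Qed.

End Psd.

(** * Tensor powers and their digits *)

Section Tensor.
Variables (R : realType) (d' : nat).
Local Notation C := (R[i]).
Local Notation d := d'.+1.

(** Digits as elements of ['I_d], so that functions of one site can be composed with them; [inord]
    needs a nonempty range, hence [d] is a successor here. *)
Definition dig n (x : 'I_(d ^ n)) (k : 'I_n) : 'I_d := inord (digit x k).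

Lemma digE n (x : 'I_(d ^ n)) (k : 'I_n) : dig x k = digit x k :> nat.
Proof. by rewrite inordK // /digit ltn_pmod. Qed.

Definition cati n m (x : 'I_(d ^ n)) (y : 'I_(d ^ m)) : 'I_(d ^ (n + m)) :=
  cast_ord (esym (expnD d n m)) (mxtens_index (x, y)).

Lemma cati_val n m (x : 'I_(d ^ n)) (y : 'I_(d ^ m)) :
  cati x y = (x * d ^ m + y)%N :> nat.
Proof. by []. Qed.

Lemma dig_catl n m (x : 'I_(d ^ n)) (y : 'I_(d ^ m)) k :
  dig (cati x y) (lshift m k) = dig x k.
Proof.
apply/val_inj; rewrite /= !digE /digit cati_val /=.
have lk := ltn_ord k; have -> : ((n + m).-1 - k = m + (n.-1 - k))%N by lia.
rewrite expnD divnMA; congr ((_ %/ _) %% _)%N.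
by rewrite divnMDl ?expn_gt0 // divn_small ?addn0.
Qed.

Lemma dig_catr n m (x : 'I_(d ^ n)) (y : 'I_(d ^ m)) k :
  dig (cati x y) (rshift n k) = dig y k.
Proof.
apply/val_inj; rewrite /= !digE /digit cati_val /=.
have lk := ltn_ord k; have -> : ((n + m).-1 - (n + k) = m.-1 - k)%N by lia.
(* Splitting [d ^ m] around the factor [d ^ e] shows that, after division by [d ^ e], the leading
   block [x] contributes a multiple of [d], which the modulus removes. *)
set e := (m.-1 - k)%N; move: (x : nat) (y : nat) => a b.
have -> : (d ^ m = d ^ (m - e).-1 * d * d ^ e)%N.
  by rewrite -expnSr -expnD; congr (_ ^ _)%N; rewrite /e; lia.
by rewrite !mulnA divnMDl ?expn_gt0 // modnMDl.
Qed.

Lemma big_cati (V : nmodType) n m (f : 'I_(d ^ (n + m)) -> V) :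
  \sum_z f z = \sum_x \sum_y f (cati x y).
Proof.
rewrite pair_big /= (reindex (fun p : 'I_(d ^ n) * 'I_(d ^ m) => cati p.1 p.2)) //=.
exists (fun z => mxtens_unindex (cast_ord (expnD d n m) z)) => [[x y] _|z _].
  by rewrite /cati cast_ordKV mxtens_indexK.
by rewrite /cati -surjective_pairing mxtens_unindexK cast_ordK.
Qed.

Lemma catiP n m (z : 'I_(d ^ (n + m))) : exists x y, z = cati x y :> 'I_(d ^ (n + m)).
Proof.
exists (mxtens_unindex (cast_ord (expnD d n m) z)).1, (mxtens_unindex (cast_ord (expnD d n m) z)).2.
by rewrite /cati -surjective_pairing mxtens_unindexK cast_ordK.
Qed.

Lemma dig1 (x : 'I_(d ^ 1)) k : dig x k = x.
Proof.
apply/val_inj; rewrite /= digE /digit /= ord1 /= subn0 expn0 divn1 modn_small //.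
Qed.

Lemma dig_inj n (x y : 'I_(d ^ n)) : (forall k, dig x k = dig y k) -> x = y.
Proof.
elim: n x y => [|n IH] x y.
  by move=> _; move: x y; rewrite expn0 => x y; rewrite !ord1.
move: x y; rewrite -[n.+1]/(1 + n)%N => x y.
have [x0 [x1 ->]] := catiP x; have [y0 [y1 ->]] := catiP y => e.
have := e (lshift n ord0); rewrite !dig_catl !dig1 => ->.
congr cati; apply: IH => k.
by have := e (rshift 1 k); rewrite !dig_catr.
Qed.

Definition digs n (x : 'I_(d ^ n)) : {ffun 'I_n -> 'I_d} := [ffun k => dig x k].

Lemma digs_bij n : bijective (@digs n).
Proof.
apply: inj_card_bij; last by rewrite card_ffun !card_ord.
move=> x y e; apply: dig_inj => k.
by have := congr1 (fun f : {ffun _} => f k) e; rewrite !ffunE.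
Qed.

Lemma ex_dig n (f : 'I_n -> 'I_d) : exists x : 'I_(d ^ n), forall k, dig x k = f k.
Proof.
have [g gK Kg] := digs_bij n; exists (g [ffun k => f k]) => k.
by have := congr1 (fun h : {ffun _} => h k) (Kg [ffun k => f k]); rewrite !ffunE.
Qed.

Lemma tensE n m (A : 'M[C]_(d ^ n)) (B : 'M[C]_(d ^ m)) x y x' y' :
  tens A B (cati x y) (cati x' y') = A x x' * B y y'.
Proof.
by rewrite /tens castmxE /= /cati !esymK !cast_ordKV tensmxE.
Qed.

Lemma trace_firstsE n m (A : 'M[C]_(d ^ (n + m))) y y' :
  trace_firsts A y y' = \sum_x A (cati x y) (cati x y').
Proof. by rewrite mxE; apply: eq_bigr => x _; rewrite castmxE. Qed.

Lemma matrix_catiP n m (A B : 'M[C]_(d ^ (n + m))) :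
  (forall x y x' y', A (cati x y) (cati x' y') = B (cati x y) (cati x' y')) -> A = B.
Proof.
move=> e; apply/matrixP => i j.
by have [x [y ->]] := catiP i; have [x' [y' ->]] := catiP j.
Qed.

Lemma tensM n m (A A' : 'M[C]_(d ^ n)) (B B' : 'M[C]_(d ^ m)) :
  tens A B *m tens A' B' = tens (A *m A') (B *m B').
Proof.
apply: matrix_catiP => x y x' y'; rewrite mxE big_cati tensE !mxE mulr_suml.
apply: eq_bigr => u _; rewrite mulr_sumr; apply: eq_bigr => v _.
by rewrite !tensE mulrACA.
Qed.

(** The diagonal [f] is constrained only on concatenated indices, so a caller may give it in any
    closed form, such as a product over digits or an average over the last sites. *)
Lemma tens_diag n m (g : 'I_(d ^ n) -> R) (h : 'I_(d ^ m) -> R)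
    (f : 'I_(d ^ (n + m)) -> R) :
  (forall x y, f (cati x y) = g x * h y) ->
  tens (diag_mx (\row_i (g i)%:C%C)) (diag_mx (\row_i (h i)%:C%C)) =
  diag_mx (\row_i (f i)%:C%C).
Proof.
move=> e; apply: matrix_catiP => x y x' y'; rewrite tensE !mxE.
have -> : (cati x y == cati x' y') = (x == x') && (y == y').
  apply/eqP/andP => [E|[/eqP -> /eqP ->] //]; split; apply/eqP; apply: dig_inj => k.
    by rewrite -(dig_catl x y) E dig_catl.
  by rewrite -(dig_catr x y) E dig_catr.
rewrite e rmorphM; case: eqP => _; last by rewrite mulr0n mul0r.
by case: eqP => _; rewrite ?mulr0n ?mulr0.
Qed.

Lemma adj_tens n m (A : 'M[C]_(d ^ n)) (B : 'M[C]_(d ^ m)) :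
  adj (tens A B) = tens (adj A) (adj B).
Proof. by apply: matrix_catiP => x y x' y'; rewrite tensE !adjE tensE rmorphM. Qed.

Lemma tens1 n m : tens (1%:M : 'M[C]_(d ^ n)) (1%:M : 'M[C]_(d ^ m)) = 1%:M.
Proof.
have e k : (1%:M : 'M[C]_(d ^ k)) = diag_mx (\row_i ((1 : R)%:C)%C).
  by apply/matrixP => i j; rewrite !mxE.
by rewrite !e; apply: tens_diag => x y; rewrite mulr1.
Qed.

Lemma tens_sp n m (U : 'M[C]_(d ^ n)) (V : 'M[C]_(d ^ m)) g h f :
  (forall x y, f (cati x y) = g x * h y) ->
  tens (sp U g) (sp V h) = sp (tens U V) f.
Proof. by move=> e; rewrite /sp -!tensM (tens_diag e) adj_tens. Qed.

Lemma unit_tens n m (U : 'M[C]_(d ^ n)) (V : 'M[C]_(d ^ m)) :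
  unit_mx U -> unit_mx V -> unit_mx (tens U V).
Proof. by rewrite /unit_mx adj_tens tensM => -> ->; rewrite tens1. Qed.

Lemma psd_tens n m (A : 'M[C]_(d ^ n)) (B : 'M[C]_(d ^ m)) :
  psdmx A -> psdmx B -> psdmx (tens A B).
Proof.
by case/psdP => P -> /psdP[Q ->]; rewrite -tensM -adj_tens; exact: psd_gram.
Qed.

Lemma tens_Dl n m (A A' : 'M[C]_(d ^ n)) (B : 'M[C]_(d ^ m)) :
  tens (A + A') B = tens A B + tens A' B.
Proof. by apply: matrix_catiP => x y x' y'; rewrite !(mxE, tensE) mulrDl. Qed.

Lemma tens_Br n m (A : 'M[C]_(d ^ n)) (B B' : 'M[C]_(d ^ m)) :
  tens A (B - B') = tens A B - tens A B'.
Proof. by apply: matrix_catiP => x y x' y'; rewrite !(mxE, tensE) mulrBr. Qed.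

Lemma tr_tens n m (A : 'M[C]_(d ^ n)) (B : 'M[C]_(d ^ m)) :
  \tr (tens A B) = \tr A * \tr B.
Proof.
rewrite /mxtrace big_cati mulr_suml; apply: eq_bigr => x _.
by rewrite mulr_sumr; apply: eq_bigr => y _; rewrite tensE.
Qed.

(** Partial trace is dual to tensoring with the identity; in this form the compatibility condition
    is used against arbitrary observables. *)
Lemma tr_trace_firsts n m (A : 'M[C]_(d ^ (n + m))) (B : 'M[C]_(d ^ m)) :
  \tr (trace_firsts A *m B) = \tr (A *m tens 1%:M B).
Proof.
rewrite /mxtrace big_cati exchange_big; apply: eq_bigr => y _ /=.
rewrite mxE; transitivity (\sum_z \sum_x A (cati x y) (cati x z) * B z y).
  by apply: eq_bigr => z _; rewrite [trace_firsts A y z]trace_firstsE mulr_suml.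
rewrite exchange_big; apply: eq_bigr => x _ /=.
rewrite mxE big_cati (bigD1 x) //= [X in _ = _ + X]big1 ?addr0.
  by apply: eq_bigr => z _; rewrite tensE mxE eqxx mul1r.
move=> x' nx; apply: big1 => z _; rewrite tensE mxE (negbTE nx) mul0r mulr0 //.
Qed.

Lemma ntensS (A : 'M[C]_d) n : ntensmx A (1 + n) = tens (A : 'M[C]_(d ^ 1)) (ntensmx A n).
Proof.
apply: (@matrix_catiP 1 n) => x y x' y'; rewrite tensE.
(* [ntensmx] ends its recursion at the first power and not at the unit matrix, so the case of a
   trailing zeroth power is checked by hand. *)
case: n y y' => [|n] y y'; last first.
  rewrite /ntensmx /= -[ntensmx_rec A n]/(ntensmx A n.+1).
  rewrite (_ : cati x y = mxtens_index (x, y) :> 'I_(d * d ^ n.+1)); last exact/val_inj.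
  rewrite (_ : cati x' y' = mxtens_index (x', y') :> 'I_(d * d ^ n.+1)); last exact/val_inj.
  by rewrite tensmxE.
have e0 (z : 'I_(d ^ 0)) : z = 0 :> nat by case: z => -[|k].
rewrite ntensmx0 mxE (_ : y == y') ?mulr1; last by apply/eqP/val_inj; rewrite /= !e0.
rewrite -[ntensmx A (1 + 0)]/A; congr (A _ _); apply/val_inj;
  by rewrite /= muln1 e0 addn0.
Qed.

Lemma ntensE (A : 'M[C]_d) n x y :
  ntensmx A n x y = \prod_k A (dig x k) (dig y k).
Proof.
elim: n x y => [|n IH].
  move=> x y; rewrite big_ord0 ntensmx0 mxE (_ : x == y) //.
  by apply/eqP/dig_inj => -[].
rewrite -[n.+1]/(1 + n)%N => x y.
have [x0 [x1 ->]] := catiP x; have [y0 [y1 ->]] := catiP y.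
rewrite ntensS tensE big_split_ord big_ord1 !dig_catl !dig1 IH; congr (_ * _).
by apply: eq_bigr => k _; rewrite !dig_catr.
Qed.

Lemma ntensD (A : 'M[C]_d) n m :
  ntensmx A (n + m) = tens (ntensmx A n) (ntensmx A m).
Proof.
apply: matrix_catiP => x y x' y'; rewrite tensE !ntensE big_split_ord.
by congr (_ * _); apply: eq_bigr => k _; rewrite ?dig_catl ?dig_catr.
Qed.

Lemma ntensM (A B : 'M[C]_d) n : ntensmx A n *m ntensmx B n = ntensmx (A *m B) n.
Proof.
elim: n => [|n IH]; first by rewrite !ntensmx0 mulmx1.
by rewrite -[n.+1]/(1 + n)%N !ntensS tensM IH.
Qed.

Lemma adj_ntens (A : 'M[C]_d) n : adj (ntensmx A n) = ntensmx (adj A) n.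
Proof.
apply/matrixP => x y; rewrite adjE !ntensE rmorph_prod.
by apply: eq_bigr => k _; rewrite adjE.
Qed.

Lemma unit_ntens (U : 'M[C]_d) n : unit_mx U -> unit_mx (ntensmx U n).
Proof.
move=> uU; elim: n => [|n IH]; first by rewrite /unit_mx ntensmx0 adj1 mulmx1.
by rewrite -[n.+1]/(1 + n)%N ntensS; exact: unit_tens.
Qed.

Lemma ntens_sp (U : 'M[C]_d) g n :
  ntensmx (sp U g) n = sp (ntensmx U n) (fun x => \prod_k g (dig x k)).
Proof.
elim: n => [|n IH].
  rewrite !ntensmx0 /sp adj1 mulmx1 mul1mx; apply/matrixP => x y.
  by rewrite !mxE big_ord0.
rewrite -[n.+1]/(1 + n)%N !ntensS IH; apply: tens_sp => x y.
rewrite big_split_ord big_ord1 dig_catl dig1; congr (_ * _).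
by apply: eq_bigr => k _; rewrite dig_catr.
Qed.

(* Digit [k] of [pidx pi x] is digit [pi k] of [x]; conjugation by [perm_op pi] reindexes
   both matrix indices by [pidx pi], see [permJ]. *)
Definition pidx n (pi : 'S_n) (x : 'I_(d ^ n)) : 'I_(d ^ n) :=
  projT1 (cid (ex_dig (fun k => dig x (pi k)))).

Lemma dig_pidx n (pi : 'S_n) x k : dig (pidx pi x) k = dig x (pi k).
Proof. by rewrite /pidx; case: cid. Qed.

Lemma pidx_inj n (pi : 'S_n) : injective (pidx pi).
Proof.
move=> x y e; apply: dig_inj => k.
by rewrite -(permKV pi k) -!dig_pidx e.
Qed.

Lemma perm_opE n (pi : 'S_n) x y : perm_op R d pi x y = (y == pidx pi x)%:R.
Proof.
rewrite mxE; congr (nat_of_bool _)%:R; apply/forallP/eqP => [h|-> k].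
  by apply: dig_inj => k; rewrite dig_pidx; apply/val_inj; rewrite /= !digE; apply/esym/eqP/h.
by rewrite -!digE dig_pidx.
Qed.

Lemma permJ n (pi : 'S_n) (A : 'M[C]_(d ^ n)) x y :
  (perm_op R d pi *m A *m adj (perm_op R d pi)) x y = A (pidx pi x) (pidx pi y).
Proof.
rewrite mxE (bigD1 (pidx pi y)) //= big1 ?addr0 => [|j /negbTE nj]; last first.
  by rewrite adjE perm_opE nj rmorph0 mulr0.
rewrite adjE perm_opE eqxx rmorph1 mulr1 mxE (bigD1 (pidx pi x)) //= big1 ?addr0.
  by rewrite perm_opE eqxx mul1r.
by move=> j /negbTE nj; rewrite perm_opE nj mul0r.
Qed.

Lemma unit_perm n (pi : 'S_n) : unit_mx (perm_op R d pi).
Proof.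
rewrite /unit_mx -{1}[perm_op R d pi]mulmx1; apply/matrixP => x y.
by rewrite permJ !mxE (inj_eq (@pidx_inj _ pi)).
Qed.

Lemma permJ_ntens n (pi : 'S_n) (A : 'M[C]_d) :
  perm_op R d pi *m ntensmx A n *m adj (perm_op R d pi) = ntensmx A n.
Proof.
apply/matrixP => x y; rewrite permJ !ntensE [RHS](reindex_inj (@perm_inj _ pi)).
by apply: eq_bigr => k _; rewrite !dig_pidx.
Qed.

Lemma wt_perm n (pi : 'S_n) (U : 'M[C]_d) (s : 'M[C]_(d ^ n)) x :
  wt (ntensmx U n) (perm_op R d pi *m s *m adj (perm_op R d pi)) x =
  wt (ntensmx U n) s (pidx pi x).
Proof.
rewrite /wt; congr complex.Re.
set P := perm_op R d pi; set W := ntensmx U n.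
(* A tensor power is fixed by conjugation with a site permutation, hence commutes with it, and the
   permutation can be moved past the change of basis. *)
have uP := unit_perm pi; have cW : W *m P = P *m W.
  have e : P *m W *m adj P = W by exact: permJ_ntens.
  by rewrite -{1}e -[_ *m P](mulmxA _ (adj P) P) (unit_mxV uP) mulmx1.
have cW' : adj P *m adj W = adj W *m adj P by rewrite -!adjM cW.
by rewrite !mulmxA cW -!mulmxA cW' !mulmxA -permJ -/P !mulmxA.
Qed.

Lemma tens_compl n m (A B : 'M[C]_(d ^ n)) (M N : 'M[C]_(d ^ m)) : A + B = 1%:M ->
  1%:M - (tens A M + tens B N) = tens A (1%:M - M) + tens B (1%:M - N).
Proof.
by move=> AB; rewrite !tens_Br addrACA -opprD -tens_Dl AB tens1.
Qed.

End Tensor.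

(** * Moments of empirical averages *)

Section Moments.
Variable (R : realType).

Definition mean (I : finType) (w h : I -> R) := \sum_x w x * h x.
Definition cov (I : finType) (w g h : I -> R) :=
  mean w (fun x => g x * h x) - mean w g * mean w h.

Lemma meanD (I : finType) (w g h : I -> R) :
  mean w (fun x => g x + h x) = mean w g + mean w h.
Proof. by rewrite -big_split; apply: eq_bigr => x _; rewrite mulrDr. Qed.

Lemma meanZ (I : finType) (w h : I -> R) a :
  mean w (fun x => a * h x) = a * mean w h.
Proof. by rewrite /mean mulr_sumr; apply: eq_bigr => x _; rewrite mulrCA. Qed.

Lemma eq_mean (I : finType) (w g h : I -> R) : g =1 h -> mean w g = mean w h.
Proof. by move=> e; apply: eq_bigr => x _; rewrite e. Qed.

Lemma mean_sum (I : finType) (w : I -> R) n (h : 'I_n -> I -> R) :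
  mean w (fun x => \sum_k h k x) = \sum_k mean w (h k).
Proof. by rewrite /mean exchange_big; apply: eq_bigr => x _; rewrite mulr_sumr. Qed.

Lemma ler_mean (I : finType) (w g h : I -> R) : (forall x, 0 <= w x) ->
  (forall x, g x <= h x) -> mean w g <= mean w h.
Proof. by move=> w0 e; apply: ler_sum => x _; exact: ler_wpM2l. Qed.

Lemma mean_cst (I : finType) (w : I -> R) a : \sum_x w x = 1 -> mean w (fun=> a) = a.
Proof. by move=> w1; rewrite /mean -mulr_suml w1 mul1r. Qed.

Lemma covE (I : finType) (w h : I -> R) : \sum_x w x = 1 ->
  mean w (fun x => (h x - mean w h) ^+ 2) = cov w h h.
Proof.
move=> w1; set m := mean w h.
rewrite (@eq_mean _ w _ (fun x => h x * h x + ((- 2 * m) * h x + m ^+ 2))); last first.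
  by move=> x; ring.
by rewrite !meanD meanZ mean_cst // /cov -/m; ring.
Qed.

Lemma covZl (I : finType) (w g h : I -> R) a : cov w (fun x => a * g x) h = a * cov w g h.
Proof.
rewrite /cov meanZ (@eq_mean _ w _ (fun x => a * (g x * h x))) ?meanZ; first by ring.
by move=> x; rewrite mulrA.
Qed.

Lemma cov_suml (I : finType) (w h : I -> R) n (g : 'I_n -> I -> R) :
  cov w (fun x => \sum_k g k x) h = \sum_k cov w (g k) h.
Proof.
rewrite /cov mean_sum mulr_suml sumrB; congr (_ - _); rewrite -mean_sum.
by apply: eq_mean => x; rewrite mulr_suml.
Qed.

(** The deviation is required only at points of positive weight, so that logarithms of vanishing
    eigenvalues never enter. The centre [m] is arbitrary. *)
Lemma chebyshev (I : finType) (w h : I -> R) (m e : R) (bad : pred I) :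
  (forall x, 0 <= w x) -> 0 < e ->
  (forall x, 0 < w x -> bad x -> e <= `|h x - m|) ->
  mean w (fun x => (bad x)%:R) <= mean w (fun x => (h x - m) ^+ 2) / e ^+ 2.
Proof.
move=> w0 e0 hb; rewrite ler_pdivlMr ?exprn_gt0 // mulrC -meanZ.
apply: ler_sum => x _; have := w0 x; rewrite le_eqVlt => /orP[/eqP <-|wx].
  by rewrite !mul0r.
apply: ler_wpM2l => //; case bx : (bad x); last by rewrite mulr0 sqr_ge0.
rewrite mulr1 -[leRHS]real_normK ?num_real //.
by rewrite ler_sqr ?nnegrE ?normr_ge0 ?(ltW e0) // hb.
Qed.

Lemma sum_dig_cati d' n (f : 'I_d'.+1 -> R) (x : 'I_(d'.+1 ^ 1)) (y : 'I_(d'.+1 ^ n)) :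
  \sum_(k < 1 + n) f (dig (cati x y) k) = f x + \sum_k f (dig y k).
Proof.
rewrite big_split_ord big_ord1 dig_catl dig1; congr (_ + _).
by apply: eq_bigr => k _; rewrite dig_catr.
Qed.

Lemma prod_dig_cati d' n (f : 'I_d'.+1 -> R) (x : 'I_(d'.+1 ^ 1)) (y : 'I_(d'.+1 ^ n)) :
  \prod_(k < 1 + n) f (dig (cati x y) k) = f x * \prod_k f (dig y k).
Proof.
rewrite big_split_ord big_ord1 dig_catl dig1; congr (_ * _).
by apply: eq_bigr => k _; rewrite dig_catr.
Qed.

Lemma big_dig (d' n : nat) (f : 'I_d'.+1 -> R) :
  \sum_(x : 'I_(d'.+1 ^ n)) \prod_k f (dig x k) = (\sum_i f i) ^+ n.
Proof.
elim: n => [|n IH].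
  have e0 (z : 'I_(d'.+1 ^ 0)) : z = Ordinal (isT : 0 < d'.+1 ^ 0)%N.
    by apply/dig_inj => -[].
  rewrite expr0 (big_pred1 (Ordinal (isT : 0 < d'.+1 ^ 0)%N)) ?big_ord0 // => z.
  exact/esym/eqP/e0.
rewrite exprS -IH -[n.+1]/(1 + n)%N big_cati mulr_suml.
apply: eq_bigr => x _; rewrite mulr_sumr; apply: eq_bigr => y _.
exact: prod_dig_cati.
Qed.

(** Variances of independent centred terms add. The vanishing mean is proved in the same induction
    because it kills the cross term of the square. *)
Lemma big_dig_sqr (d' n : nat) (q h : 'I_d'.+1 -> R) :
  \sum_i q i = 1 -> mean q h = 0 ->
  mean (fun x : 'I_(d'.+1 ^ n) => \prod_k q (dig x k)) (fun x => \sum_k h (dig x k)) = 0 /\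
  mean (fun x : 'I_(d'.+1 ^ n) => \prod_k q (dig x k))
    (fun x => (\sum_k h (dig x k)) ^+ 2) = n%:R * mean q (fun i => h i ^+ 2).
Proof.
move=> q1 h0; elim: n => [|n [IH1 IH2]].
  by rewrite mul0r; split; apply: big1 => x _; rewrite !big_ord0 ?expr0n mulr0.
rewrite -[n.+1]/(1 + n)%N /mean !big_cati.
have P1 : \sum_(x : 'I_(d'.+1 ^ n)) \prod_k q (dig x k) = 1 by rewrite big_dig q1 expr1n.
(* Writes a quantity of the first digit as a sum over the remaining digits, using that their total
   mass is 1; both sides can then be compared term by term. *)
have E (a : R) : a = \sum_(y : 'I_(d'.+1 ^ n)) a * \prod_k q (dig y k) by rewrite -mulr_sumr P1 mulr1.
split.
  transitivity (\sum_(i : 'I_d'.+1) q i * h i).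
    apply: eq_bigr => x _; rewrite [RHS]E.
    apply/eqP; rewrite -subr_eq0 -sumrB; apply/eqP.
    transitivity (\sum_y q x * ((\prod_k q (dig y k)) * \sum_(k < n) h (dig y k))).
      apply: eq_bigr => y _.
      by rewrite (prod_dig_cati q x y) (sum_dig_cati h x y); ring.
    by rewrite -mulr_sumr -/(mean _ _) IH1 mulr0.
  exact: h0.
transitivity (\sum_(x : 'I_d'.+1) (q x * h x ^+ 2 + q x * (n%:R * mean q (fun i => h i ^+ 2)))).
  apply: eq_bigr => x _; rewrite -IH2 [q x * h x ^+ 2]E /mean mulr_sumr.
  have Z : \sum_(y : 'I_(d'.+1 ^ n))
      (2 * q x * h x) * ((\prod_k q (dig y k)) * \sum_(k < n) h (dig y k)) = 0.
    by rewrite -mulr_sumr -/(mean _ _) IH1 mulr0.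
  rewrite -[RHS]addr0 -[X in _ = _ + X]Z -!big_split /=.
  apply: eq_bigr => y _.
  by rewrite (prod_dig_cati q x y) (sum_dig_cati h x y); ring.
by rewrite big_split /= -mulr_suml q1 natrD; rewrite -/(mean _ _) /=; ring.
Qed.

End Moments.

(** * Typical projections *)

Section Tests.
Variables (R : realType) (d' : nat).
Local Notation C := (R[i]).
Local Notation d := d'.+1.

Definition davg n (g : 'I_d -> R) (x : 'I_(d ^ n)) : R := n%:R^-1 * \sum_k g (dig x k).

(* The outcome distribution of measuring every site of [s] in the basis [U]. *)
Definition dwt n (U : 'M[C]_d) (s : 'M[C]_(d ^ n)) := wt (ntensmx U n) s.

Lemma dwt_density n (U : 'M[C]_d) (s : 'M[C]_(d ^ n)) : unit_mx U -> density s ->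
  (forall x, 0 <= dwt U s x) /\ \sum_x dwt U s x = 1.
Proof. by move=> uU; apply: density_wt; exact: unit_ntens. Qed.

Lemma sum_davg n (g : 'I_d -> R) (x : 'I_(d ^ n)) : (0 < n)%N ->
  \sum_k g (dig x k) = n%:R * davg g x.
Proof. by move=> n0; rewrite /davg mulVKf // pnatr_eq0 -lt0n. Qed.

Lemma expR_davg n (g : 'I_d -> R) (x : 'I_(d ^ n)) : (0 < n)%N ->
  \prod_k expR (g (dig x k)) = expR (n%:R * davg g x).
Proof. by move=> n0; rewrite -sum_davg // expR_sum. Qed.

(** The complement of the test is [Q + P2 *m N *m P2]. Pinching with [1] and [- Q] bounds the second
    term by twice [N] plus twice [Q *m N *m Q], and the latter is at most [Q]. *)
Lemma rtr_compression k (P1 P2 Q N s : 'M[C]_k) :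
  P1 = 1%:M - N -> P2 = 1%:M - Q -> adj Q = Q -> P2 *m P2 = P2 -> Q *m Q = Q ->
  test N -> psdmx s ->
  rtr ((1%:M - P2 *m P1 *m P2) *m s) <= 3 * rtr (Q *m s) + 2 * rtr (N *m s).
Proof.
move=> -> eP2 hQ eP QQ tN ps.
have -> : 1%:M - P2 *m (1%:M - N) *m P2 = Q + P2 *m N *m P2.
  have eQ : Q = 1%:M - P2 by rewrite eP2 subKr.
  by rewrite mulmxBr mulmx1 mulmxBl eP [in RHS]eQ opprB addrCA addrC.
rewrite mulmxDl rtrD.
have hmQ : adj (- Q) = - Q by rewrite adjN hQ.
have := rtr_pinching (adj1 R k) hmQ tN.1 ps.
rewrite -eP2 mul1mx mulmx1 !(mulNmx, mulmxN) opprK.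
have := rtr_conj_test hQ tN ps; rewrite QQ.
by move: (rtr (Q *m s)) (rtr (N *m s)) (rtr _) (rtr _) => x y z t; lra.
Qed.

(* The test is [P2 P1 P2], with [P2] spanned by the product eigenvectors of [rho] of small
   weight and [P1] by those product vectors of the second basis that carry [s]; the trace of
   [P1] is at most [expR (- n (a - e))]. *)
Lemma typical_test n (s : 'M[C]_(d ^ n)) (U V : 'M[C]_d) (g1 g2 mu : 'I_d -> R) (e v : R) :
  (0 < n)%N -> density s -> unit_mx U -> unit_mx V -> 0 < e ->
  cov (dwt V s) (davg g1) (davg g1) <= v ->
  cov (dwt U s) (davg g2) (davg g2) <= v ->
  (forall i, 0 <= mu i <= expR (g2 i)) ->
  \sum_i expR (g1 i) <= 1 ->
  exists M, [/\ test M, rtr ((1%:M - M) *m s) <= 5 * v / e ^+ 2 &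
    rtr (M *m ntensmx (sp U mu) n) <=
    expR (n%:R * (mean (dwt U s) (davg g2) - mean (dwt V s) (davg g1) + 2 * e))].
Proof.
move=> n0 ds uU uV e0 v1 v2 hmu hg1.
have ps : psdmx s by case: ds.
set a := mean (dwt V s) _; set b := mean (dwt U s) _.
have nR : (0 : R) < n%:R by rewrite ltr0n.
have [uUn uVn] := (unit_ntens n uU, unit_ntens n uV).
have [w20 w21] := dwt_density uU ds; have [w10 w11] := dwt_density uV ds.
pose i2 (x : 'I_(d ^ n)) : bool := davg g2 x <= b + e.
pose i1 (x : 'I_(d ^ n)) : bool := a - e <= davg g1 x.
pose P2 := sp (ntensmx U n) (fun x => (i2 x)%:R : R).
pose P1 := sp (ntensmx V n) (fun x => (i1 x)%:R : R).
pose Q := sp (ntensmx U n) (fun x => (~~ i2 x)%:R : R).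
pose N := sp (ntensmx V n) (fun x => (~~ i1 x)%:R : R).
have P2P2 : P2 *m P2 = P2 by exact: spb_idem.
have QQ : Q *m Q = Q by exact: (@spb_idem _ _ _ (fun x => ~~ i2 x)).
have hP2 : adj P2 = P2 by exact: adj_sp.
have hQ : adj Q = Q by exact: adj_sp.
have tP2 : test P2 by exact: test_spb.
have tP1 : test P1 by exact: test_spb.
have tN : test N by exact: (@test_spb _ _ _ (fun x => ~~ i1 x)).
have P2E : P2 = 1%:M - Q by exact: spbC.
have P1E : P1 = 1%:M - N by exact: spbC.
have cheb (w : 'I_(d ^ n) -> R) h (bad : pred 'I_(d ^ n)) : (forall x, 0 <= w x) -> \sum_x w x = 1 ->
    cov w h h <= v -> (forall x, bad x -> e <= `|h x - mean w h|) ->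
    mean w (fun x => (bad x)%:R) <= v / e ^+ 2.
  move=> w0 w1 hv hb; apply: le_trans (chebyshev w0 e0 (fun x _ => hb x)) _.
  by rewrite covE // ler_pM2r // invr_gt0 exprn_gt0.
have Qs : rtr (Q *m s) <= v / e ^+ 2.
  rewrite rtr_sp_mul; apply: (cheb _ (davg g2)) => // x; rewrite -ltNge -/b => hx.
  by rewrite ler_normr; apply/orP; left; lra.
have Ns : rtr (N *m s) <= v / e ^+ 2.
  rewrite rtr_sp_mul; apply: (cheb _ (davg g1)) => // x; rewrite -ltNge -/a => hx.
  by rewrite ler_normr; apply/orP; right; lra.
exists (P2 *m P1 *m P2); split.
- by have h := @testJ _ _ P2 P1; rewrite hP2 P2P2 in h; exact: (h tP2 tP1).
- apply: le_trans (rtr_compression P1E P2E hQ P2P2 QQ tN ps) _.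
  by rewrite -mulrA; move: (v / _) (rtr _) (rtr _) Qs Ns => z x y h1 h2; lra.
- rewrite ntens_sp rtr_compressC /P2 !spM // rtr_sp.
  have wP1 x : 0 <= wt (ntensmx U n) P1 x by apply: wt_ge0; case: tP1.
  (* On the range of [P2] the eigenvalues of the power of [sp U mu] are at most
     [expR (n%:R * (b + e))]; what remains is the trace of [P1]. *)
  apply: (@le_trans _ _ (\sum_x wt (ntensmx U n) P1 x * expR (n%:R * (b + e)))).
    apply: ler_sum => x _; apply: ler_wpM2l => //.
    case i2x : (i2 x); last by rewrite mul0r mul0r expR_ge0.
    rewrite mul1r mulr1; apply: (@le_trans _ _ (expR (n%:R * davg g2 x))).
      by rewrite -expR_davg //; apply: ler_prod => k _.
    by rewrite ler_expR ler_pM2l.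
  rewrite -mulr_suml sum_wt // /P1 rtr_sp0 //.
  apply: (@le_trans _ _ (expR (- (n%:R * (a - e))) * expR (n%:R * (b + e)))); last first.
    by rewrite -expRD ler_expR le_eqVlt; apply/orP; left; apply/eqP; ring.
  apply: ler_wpM2r; first exact: expR_ge0.
  (* Exponential Markov bound for the rank of [P1]: its indicator is dominated by a product over
     sites, whose sum is the [n]-th power of a number at most 1. *)
  apply: (@le_trans _ _ (\sum_(x : 'I_(d ^ n)) expR (- (n%:R * (a - e))) * \prod_k expR (g1 (dig x k)))).
    apply: ler_sum => x _; rewrite expR_davg // -expRD.
    case i1x : (i1 x); last exact: expR_ge0.
    rewrite -[leLHS]expR0 ler_expR addrC -mulrBr; apply: mulr_ge0; first exact: ltW.
    by rewrite subr_ge0.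
  rewrite -mulr_sumr (big_dig n (fun i => expR (g1 i))) -[leRHS]mulr1; apply: ler_wpM2l; first exact: expR_ge0.
  by apply: exprn_ile1 => //; apply: sumr_ge0 => i _; exact: expR_ge0.
Qed.

Lemma wtE k (W s : 'M[C]_k) i : adj s = s -> (W *m s *m adj W) i i = ((wt W s i)%:C)%C.
Proof.
move=> hs; rewrite /wt; set A := W *m s *m adj W.
have hA : adj A = A by rewrite /A !adjM adjK hs mulmxA.
have : conjC (A i i) = A i i by rewrite -adjE hA.
case: (A i i) => a b /eqP; rewrite conjCE eq_complex /= => /andP[_ /eqP e].
by congr (_ +i* _)%C; lra.
Qed.

Lemma dwt_ntens n (U s : 'M[C]_d) (x : 'I_(d ^ n)) : adj s = s ->
  dwt U (ntensmx s n) x = \prod_k wt U s (dig x k).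
Proof.
move=> hs; rewrite /dwt /wt adj_ntens !ntensM ntensE.
transitivity (complex.Re ((\prod_k wt U s (dig x k))%:C)%C); last by [].
by rewrite rmorph_prod; congr complex.Re; apply: eq_bigr => k _; rewrite wtE.
Qed.

(** The weak law of large numbers with rate [1 / n]: centring [h] and applying [big_dig_sqr] gives
    the variance of the average. *)
Lemma iid_chebyshev n (q h : 'I_d -> R) (e : R) (bad : pred 'I_(d ^ n)) :
  (0 < n)%N -> (forall i, 0 <= q i) -> \sum_i q i = 1 -> 0 < e ->
  (forall x, (forall k, 0 < q (dig x k)) -> bad x -> e <= `|davg h x - mean q h|) ->
  mean (fun x : 'I_(d ^ n) => \prod_k q (dig x k)) (fun x => (bad x)%:R) <=
  mean q (fun i => (h i - mean q h) ^+ 2) / e ^+ 2 / n%:R.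
Proof.
move=> n0 q0 q1 e0 hb; set P := fun x : 'I_(d ^ n) => \prod_k q (dig x k).
have nR : (n%:R : R) != 0 by rewrite pnatr_eq0 -lt0n.
have P0 x : 0 <= P x by apply: prodr_ge0.
apply: le_trans (chebyshev P0 e0 (m := mean q h) (h := davg h) _) _.
  move=> x Px; apply: hb => k; rewrite lt_neqAle q0 andbT eq_sym.
  by apply: contraTneq Px => qk; rewrite /P (bigD1 k) //= qk mul0r ltxx.
rewrite mulrAC ler_pM2r ?invr_gt0 ?exprn_gt0 //.
pose g i := h i - mean q h.
have g0 : mean q g = 0.
  rewrite (eq_mean _ (h := fun i => h i + - mean q h)) // meanD mean_cst //.
  by rewrite subrr.
have [_ H] := big_dig_sqr n q1 g0.
rewrite (eq_mean _ (h := fun x => n%:R^-1 ^+ 2 * (\sum_k g (dig x k)) ^+ 2)).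
  rewrite meanZ H -/(mean _ _) le_eqVlt; apply/orP; left; apply/eqP.
  by rewrite /g; field.
move=> x; rewrite -exprMn; congr (_ ^+ 2); rewrite /g sumrB sumr_const card_ord /davg.
by rewrite mulrBr -(mulr_natl (mean q h)) mulKf.
Qed.

Lemma converse_sum (x p y z E t k1 k2 N : R) :
  x <= p *+ 2 + y *+ 2 -> y <= k1 / N -> p <= z + k2 / N -> z <= E * t ->
  x <= 2 * E * t + (2 * k1 + 2 * k2) / N.
Proof.
move=> h1 h2 h3 h4; have -> : 2 * E * t + (2 * k1 + 2 * k2) / N =
  2 * (E * t) + 2 * (k1 / N) + 2 * (k2 / N) by ring.
by move: h1 h2 h3 h4; move: (E * t) (k1 / N) (k2 / N) => a b c h1 h2 h3 h4; lra.
Qed.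

(** The difference of the two means is the relative entropy of the two states. Pinching splits the
    test along the typical projection of the powers of [sp U mu]; the atypical parts go into [K],
    which depends neither on [n] nor on the test. *)
Lemma product_converse (U V : 'M[C]_d) (lam mu : 'I_d -> R) (e : R) :
  unit_mx U -> unit_mx V -> density (sp V lam) -> (forall i, 0 <= mu i) ->
  (forall i, mu i = 0 -> wt U (sp V lam) i = 0) -> 0 < e ->
  exists K : R, forall n, (0 < n)%N -> forall M : 'M[C]_(d ^ n), test M ->
  rtr (M *m ntensmx (sp V lam) n) <=
  2 * expR (n%:R * (mean lam (fun i => ln (lam i))
     - mean (wt U (sp V lam)) (fun i => ln (mu i)) + 2 * e))
   * rtr (M *m ntensmx (sp U mu) n) + K / n%:R.
Proof.
move=> uU uV ds mu0 supp e0.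
set q := wt U (sp V lam); set a := mean lam _; set b := mean q _.
pose K1 := mean q (fun i => (ln (mu i) - b) ^+ 2) / e ^+ 2.
pose K2 := mean lam (fun i => (ln (lam i) - a) ^+ 2) / e ^+ 2.
have ps : psdmx (sp V lam) by case: ds.
have [q0 q1] := density_wt uU ds.
have [l0 l1] : (forall i, 0 <= lam i) /\ \sum_i lam i = 1.
  have [h0 h1] := density_wt uV ds; split.
    by move=> i; rewrite -(wt_sp lam i uV).
  by rewrite -h1; apply: eq_bigr => i _; rewrite wt_sp.
exists (2 * K1 + 2 * K2) => n n0 M tM.
have [uUn uVn] := (unit_ntens n uU, unit_ntens n uV).
have nR : (0 : R) < n%:R by rewrite ltr0n.
pose i2 (x : 'I_(d ^ n)) : bool := expR (n%:R * (b - e)) <= \prod_k mu (dig x k).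
pose i1 (x : 'I_(d ^ n)) : bool := \prod_k lam (dig x k) <= expR (n%:R * (a + e)).
have bad2 : mean (fun x : 'I_(d ^ n) => \prod_k q (dig x k)) (fun x => (~~ i2 x)%:R) <= K1 / n%:R.
  apply: iid_chebyshev => // x qx; rewrite -ltNge => hx.
  (* By the support condition a digit of positive weight has a positive eigenvalue, so the product
     of eigenvalues is the exponential of a sum of logarithms. *)
  have mx k : 0 < mu (dig x k).
    by rewrite lt_neqAle mu0 andbT eq_sym; apply: contraTneq (qx k) => /supp; rewrite -/q => ->; rewrite ltxx.
  rewrite ler_normr; apply/orP; right; rewrite -/b.
  move: hx; under eq_bigr do rewrite -(lnK (mx _)).
  by rewrite (expR_davg (fun i => ln (mu i))) // ltr_expR ltr_pM2l // => hx; lra.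
have bad1 : mean (fun x : 'I_(d ^ n) => \prod_k lam (dig x k)) (fun x => (~~ i1 x)%:R) <= K2 / n%:R.
  apply: iid_chebyshev => // x mx; rewrite -ltNge => hx.
  rewrite ler_normr; apply/orP; left; rewrite -/a.
  move: hx; under eq_bigr do rewrite -(lnK (mx _)).
  by rewrite (expR_davg (fun i => ln (lam i))) // ltr_expR ltr_pM2l // => hx; lra.
pose s := ntensmx (sp V lam) n; pose r := ntensmx (sp U mu) n.
have ps' : psdmx s.
  by rewrite /s ntens_sp; apply: psd_sp => x; apply: prodr_ge0.
pose P := sp (ntensmx U n) (fun x => (i2 x)%:R : R).
pose Q := sp (ntensmx U n) (fun x => (~~ i2 x)%:R : R).
have PQ : P + Q = 1%:M by rewrite /P spbC // subrK.
have PP : P *m P = P by exact: spb_idem.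
have QQ : Q *m Q = Q by exact: (@spb_idem _ _ _ (fun x => ~~ i2 x)).
have hP : adj P = P by exact: adj_sp.
have hQ : adj Q = Q by exact: adj_sp.
have tP : test P by exact: test_spb.
have Qs : rtr (Q *m s) <= K1 / n%:R.
  rewrite rtr_sp_mul; apply: le_trans bad2; apply: ler_sum => x _.
  by rewrite -[wt _ s x]/(dwt U s x) dwt_ntens // psd_herm.
have key := rtr_pinching hP hQ tM.1 ps'.
rewrite PQ mul1mx mulmx1 in key.
have hQMQ := rtr_conj_test hQ tM ps'; rewrite QQ in hQMQ.
have tN : test (P *m M *m P) by have h := @testJ _ _ P M; rewrite hP PP in h; exact: (h tP tM).
(* Eigenvalues of [s] above the typical size carry mass at most [K2 / n%:R], and there the test is
   bounded by 1; elsewhere the eigenvalue is bounded and the weights sum to the trace of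
   [P *m M *m P]. *)
have h1 : rtr (P *m M *m P *m s) <= expR (n%:R * (a + e)) * rtr (P *m M *m P) + K2 / n%:R.
  rewrite /s ntens_sp rtr_sp.
  have [pN pN'] := tN.
  have wN0 x := wt_ge0 (ntensmx V n) x pN.
  have wN1 x : wt (ntensmx V n) (P *m M *m P) x <= 1.
    rewrite -subr_ge0 -(wt_sp (fun=> 1) x uVn) sp1 //.
    have := wt_ge0 (ntensmx V n) x pN'; rewrite /wt mulmxBr mulmxBl.
    by rewrite [X in complex.Re X]mxE [X in complex.Re (_ + X)]mxE ReD ReN.
  apply: (@le_trans _ _ (\sum_x (expR (n%:R * (a + e)) * wt (ntensmx V n) (P *m M *m P) x
     + (\prod_k lam (dig x k)) * (~~ i1 x)%:R))).
    apply: ler_sum => x _; have L0 : 0 <= \prod_k lam (dig x k) by apply: prodr_ge0.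
    case i1x : (i1 x).
      by rewrite mulr0 addr0 mulrC; apply: ler_wpM2r.
    rewrite mulr1; apply: (@le_trans _ _ (\prod_k lam (dig x k))).
      by rewrite -[leRHS]mul1r; apply: ler_wpM2r.
    by rewrite lerDr mulr_ge0 ?expR_ge0.
  by rewrite big_split /= -mulr_sumr sum_wt // lerD2l.
(* [P] and [r] are diagonal in the same basis, and on the range of [P] the eigenvalues of [r] are at
   least [expR (n%:R * (b - e))], so [P] is at most a multiple of [r]. *)
have h2 : rtr (P *m M *m P) <= expR (- (n%:R * (b - e))) * rtr (M *m r).
  have -> : rtr (P *m M *m P) = rtr (M *m P).
    by rewrite rtrC [P *m (P *m M)]mulmxA PP rtrC.
  rewrite /r ntens_sp !rtr_sp mulr_sumr.
  apply: ler_sum => x _; rewrite mulrCA; apply: ler_wpM2l.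
    by apply: wt_ge0; case: tM.
  have M0 : 0 <= \prod_k mu (dig x k) by apply: prodr_ge0.
  case i2x : (i2 x); last by rewrite mulr_ge0 ?expR_ge0.
  by rewrite expRN mulrC ler_pdivlMr ?expR_gt0 // mul1r.
have h3 : expR (n%:R * (a + e)) * rtr (P *m M *m P) <=
    expR (n%:R * (a - b + 2 * e)) * rtr (M *m r).
  apply: le_trans (ler_wpM2l (expR_ge0 _) h2) _.
  rewrite mulrA -expRD le_eqVlt; apply/orP; left; apply/eqP; congr (expR _ * _); ring.
exact: (converse_sum key (le_trans hQMQ Qs) h1 h3).
Qed.

Lemma mean_dwt n (V : 'M[C]_d) (q : 'M[C]_(d ^ n)) h :
  mean (dwt V q) h = rtr (sp (ntensmx V n) h *m q).
Proof. by rewrite rtr_sp_mul. Qed.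

End Tests.

(** * Hilbert-Schmidt inner product, purity and operator norm *)

Section HilbertSchmidt.
Variable R : realType.
Local Notation C := (R[i]).

Lemma rtr_sqr_ge0 k (A : 'M[C]_k) : adj A = A -> 0 <= rtr (A *m A).
Proof. by move=> hA; rewrite -{1}hA; exact: rtr_gram_ge0. Qed.

Definition ip k (A B : 'M[C]_k) := rtr (A *m B).

Lemma ipDl k (A B D : 'M[C]_k) : ip (A + B) D = ip A D + ip B D.
Proof. by rewrite /ip mulmxDl rtrD. Qed.

Lemma ipBl k (A B D : 'M[C]_k) : ip (A - B) D = ip A D - ip B D.
Proof. by rewrite /ip mulmxBl rtrB. Qed.

Lemma ipZl k a (A D : 'M[C]_k) : ip ((a%:C)%C *: A) D = a * ip A D.
Proof. by rewrite /ip -scalemxAl rtrZ. Qed.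

Lemma ipC k (A B : 'M[C]_k) : ip A B = ip B A.
Proof. exact: rtrC. Qed.

Lemma ipDr k (A B D : 'M[C]_k) : ip D (A + B) = ip D A + ip D B.
Proof. by rewrite ipC ipDl ![ip _ D]ipC. Qed.

Lemma ipBr k (A B D : 'M[C]_k) : ip D (A - B) = ip D A - ip D B.
Proof. by rewrite ipC ipBl ![ip _ D]ipC. Qed.

Lemma ipZr k a (A D : 'M[C]_k) : ip D ((a%:C)%C *: A) = a * ip D A.
Proof. by rewrite ipC ipZl ipC. Qed.

Lemma rtr_CS k (A B : 'M[C]_k) : adj A = A -> adj B = B ->
  ip A B ^+ 2 <= ip A A * ip B B.
Proof.
move=> hA hB; have QQ (t u : R) : 0 <= t ^+ 2 * ip A A - 2 * t * u * ip A B + u ^+ 2 * ip B B.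
  have h : adj ((t%:C)%C *: A - (u%:C)%C *: B) = (t%:C)%C *: A - (u%:C)%C *: B.
    by rewrite adjB !adjZ hA hB.
  have := rtr_sqr_ge0 h; rewrite -/(ip _ _) ipBl !ipBr !ipZl !ipZr (ipC B A).
  by congr (0 <= _); ring.
have a0 : 0 <= ip A A by exact: rtr_sqr_ge0.
have b0 : 0 <= ip B B by exact: rtr_sqr_ge0.
move: (ip A B) (ip A A) (ip B B) QQ a0 b0 => x a b Q a0 b0.
have := Q x a.
case: (eqVneq a 0) => [a00|an0]; last first.
  have ap : 0 < a by rewrite lt_neqAle eq_sym an0.
  have -> : x ^+ 2 * a - 2 * x * a * x + a ^+ 2 * b = a * (a * b - x ^+ 2) by ring.
  by rewrite pmulr_rge0 // subr_ge0.
rewrite a00 mul0r => _.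
case: (eqVneq x 0) => [->|xn0]; first by rewrite expr0n.
(* When [ip A A] vanishes the quadratic form is affine in its first argument; this value makes it
   equal to [-1], so [x] must be 0. *)
have := Q ((b + 1) / (2 * x)) 1; rewrite a00 mulr0 add0r expr1n mul1r mulr1.
have -> : 2 * ((b + 1) / (2 * x)) * x = b + 1 by field.
by move=> h; lra.
Qed.

(** The source of the purity gain: splitting a mixture into its two components raises the mean
    purity by a multiple of their squared distance. *)
Lemma rtr_convex k (a b : R) (u v : 'M[C]_k) : a + b = 1 ->
  let w := (a%:C)%C *: u + (b%:C)%C *: v in
  a * ip u u + b * ip v v = ip w w + a * b * ip (u - v) (u - v).
Proof.
move=> ab w; rewrite ipBl !ipBr /w !ipDl !ipDr !ipZl !ipZr (ipC v u).
move: (ip u u) (ip u v) (ip v v) => x y z.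
have -> : b = 1 - a by rewrite -ab addrC addKr.
by ring.
Qed.

Lemma rtr_density_sqr k (s : 'M[C]_k) : density s -> rtr (s *m s) <= 1.
Proof.
move=> ds; have [W [h [uW es h0]]] := psd_spectral ds.1.
have h1 : \sum_i h i = 1 by rewrite -(rtr_sp0 h uW) -es density_rtr.
rewrite es spM // rtr_sp0 // -h1; apply: ler_sum => i _.
rewrite -[leRHS]mulr1; apply: ler_wpM2l => //.
by rewrite -h1 (bigD1 i) //= lerDl sumr_ge0.
Qed.

(** Holds because [c ^+ 2] times the identity minus the square of the operator is positive. *)
Lemma opnorm_sp k (U : 'M[C]_k) (h : 'I_k -> R) (c : R) : unit_mx U -> 0 <= c ->
  (forall i, `|h i| <= c) -> opnorm (sp U h) <= c.
Proof.
move=> uU c0 hc; apply: ge_sup.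
  exists (vnorm (sp U h *m 0)), 0; split => //.
  by rewrite /vnorm mulmx0 mxE sqrtr0 ler01.
move=> _ [v [v1 ->]]; set X := sp U h.
have p : psdmx ((c ^+ 2)%:C%C *: 1%:M - X *m X).
  rewrite /X spM // -(sp1 uU) spZ spB; apply: psd_sp => i.
  rewrite mulr1 subr_ge0 -expr2 -real_normK ?num_real // ler_sqr ?nnegrE //.
have ReB (A B : 'M[C]_1) : complex.Re ((A - B) 0 0) = complex.Re (A 0 0) - complex.Re (B 0 0).
  by rewrite !mxE ReD ReN.
have ReZ' (A : 'M[C]_1) a : complex.Re (((a%:C)%C *: A) 0 0) = a * complex.Re (A 0 0).
  by rewrite mxE ReZ.
have H : complex.Re ((adj (X *m v) *m (X *m v)) 0 0) <= c ^+ 2 * complex.Re ((adj v *m v) 0 0).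
  have := Re_ge0 (p.2 v); rewrite mulmxBr mulmxBl -scalemxAr mulmx1 -scalemxAl.
  by rewrite ReB ReZ' subr_ge0 adjM adj_sp !mulmxA.
rewrite /vnorm (le_trans (ler_wsqrtr H)) // sqrtrM ?sqr_ge0 // sqrtr_sqr ger0_norm //.
by rewrite -[leRHS]mulr1; apply: ler_wpM2l.
Qed.

End HilbertSchmidt.

(** * Klein's inequality and compactness *)

Section Entropy.
Variable R : realType.
Local Notation C := (R[i]).

Definition ind k (i : 'I_k) (j : 'I_k) : R := (j == i)%:R.

Lemma sum_ind k (i : 'I_k) (h : 'I_k -> R) : \sum_j ind i j * h j = h i.
Proof.
rewrite (bigD1 i) //= /ind eqxx mul1r big1 ?addr0 // => j /negbTE ->.
by rewrite mul0r.
Qed.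

Lemma wt_rtr k (W s : 'M[C]_k) j : wt W s j = rtr (s *m sp W (ind j)).
Proof.
rewrite rtr_sp -[LHS](sum_ind j (wt W s)); apply: eq_bigr => i _; exact: mulrC.
Qed.

Lemma wt_sp_sum k (V W : 'M[C]_k) lam j :
  wt W (sp V lam) j = \sum_i wt V (sp W (ind j)) i * lam i.
Proof. by rewrite wt_rtr rtr_sp_mul. Qed.

Lemma wt_ind_sym k (V W : 'M[C]_k) i j : wt V (sp W (ind j)) i = wt W (sp V (ind i)) j.
Proof. by rewrite !wt_rtr rtrC. Qed.

Lemma ln_gibbs (x y : R) : 0 <= x -> 0 < y -> x * (ln y - ln x) <= y - x.
Proof.
rewrite le_eqVlt => /orP[/eqP <- y0|x0 y0]; first by rewrite mul0r subr0 ltW.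
rewrite -ln_div ?posrE //.
have h : ln (y / x) <= y / x - 1.
  have : -1 < y / x - 1 by rewrite ltrBrDr addNr divr_gt0.
  by move/le_ln1Dx; rewrite addrC subrK.
apply: le_trans (ler_wpM2l (ltW x0) h) _.
by rewrite mulrBr mulr1 mulrCA mulfV ?gt_eqF // mulr1.
Qed.

(** The overlaps of two orthonormal bases form a doubly stochastic matrix [D]; averaging the scalar
    inequality [ln_gibbs] over [D] gives the claim. Total mass at most 1 suffices for [nu]. *)
Lemma klein k (V W : 'M[C]_k) (lam nu : 'I_k -> R) : unit_mx V -> unit_mx W ->
  (forall i, 0 <= lam i) -> \sum_i lam i = 1 -> (forall j, 0 < nu j) -> \sum_j nu j <= 1 ->
  mean (wt W (sp V lam)) (fun j => ln (nu j)) <= mean lam (fun i => ln (lam i)).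
Proof.
move=> uV uW l0 l1 n0 n1; rewrite -subr_le0.
pose D i j := wt V (sp W (ind j)) i.
have D0 i j : 0 <= D i j by apply/wt_ge0/psd_sp => x; rewrite /ind ler0n.
have Di i : \sum_j D i j = 1.
  rewrite /D; under eq_bigr do rewrite wt_ind_sym.
  rewrite sum_wt // rtr_sp0 // -[RHS](sum_ind i (fun=> 1)).
  by apply: eq_bigr => j _; rewrite mulr1.
have Dj j : \sum_i D i j = 1.
  rewrite /D sum_wt // rtr_sp0 // -[RHS](sum_ind j (fun=> 1)).
  by apply: eq_bigr => i _; rewrite mulr1.
have e1 : mean (wt W (sp V lam)) (fun j => ln (nu j)) = \sum_i \sum_j D i j * (lam i * ln (nu j)).
  rewrite exchange_big; apply: eq_bigr => j _; rewrite wt_sp_sum mulr_suml.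
  by apply: eq_bigr => i _; rewrite mulrA.
have e2 : mean lam (fun i => ln (lam i)) = \sum_i \sum_j D i j * (lam i * ln (lam i)).
  by apply: eq_bigr => i _; rewrite -mulr_suml Di mul1r.
have e3 : \sum_j nu j = \sum_i \sum_j D i j * nu j.
  by rewrite exchange_big; apply: eq_bigr => j _; rewrite -mulr_suml Dj mul1r.
have e4 : \sum_i lam i = \sum_i \sum_j D i j * lam i.
  by apply: eq_bigr => i _; rewrite -mulr_suml Di mul1r.
apply: (@le_trans _ _ (\sum_j nu j - \sum_i lam i)); last by rewrite l1 subr_le0.
rewrite e1 e2 e3 e4 -!sumrB; apply: ler_sum => i _; rewrite -!sumrB; apply: ler_sum => j _.
by rewrite -!mulrBr; apply: ler_wpM2l => //; exact: ln_gibbs.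
Qed.

(** Restates the kernel inclusion in [relent] through diagonal entries. For positive [s], written
    [adj Q *m Q], a zero diagonal entry means that [Q], hence [s], kills the basis vector. *)
Lemma sp_kerP k (U s : 'M[C]_k) (mu : 'I_k -> R) : unit_mx U -> psdmx s ->
  (forall v : 'cV[C]_k, sp U mu *m v = 0 -> s *m v = 0) <->
  (forall i, mu i = 0 -> wt U s i = 0).
Proof.
move=> uU ps; split=> [h i mi|h v].
  have hv : sp U mu *m (adj U *m delta_mx i 0) = 0 :> 'cV[C]_k.
    rewrite /sp -!mulmxA [U *m _]mulmxA uU mul1mx; apply/colP => j.
    have -> : diag_mx (\row_i (mu i)%:C%C) *m delta_mx i 0 = 0 :> 'cV[C]_k.
      apply/colP => l; rewrite mul_diag_mx !mxE; case: eqP => [->|_]; last by rewrite mulr0.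
      by rewrite mi mul0r.
    by rewrite mulmx0.
  have := h _ hv; rewrite /wt => e.
  have : (U *m s *m adj U) *m delta_mx i 0 = 0 :> 'cV[C]_k.
    by rewrite -!mulmxA e mulmx0.
  by rewrite -colE => /colP/(_ i); rewrite !mxE => ->.
case/psdP: ps h => Q -> h hv.
have QU i : mu i = 0 -> Q *m (adj U *m delta_mx i 0) = 0 :> 'cV[C]_k.
  move=> /h; rewrite /wt => e; apply/colP => j; rewrite [RHS]mxE.
  set y := Q *m _; have : complex.Re ((adj y *m y) 0 0) = 0.
    rewrite -[RHS]e /y !adjM adjK; congr complex.Re.
    have -> : adj (delta_mx i 0 : 'cV[C]_k) = delta_mx 0 i.
      by apply/matrixP => a b; rewrite !mxE andbC; case: (_ && _); rewrite ?rmorph1 ?rmorph0.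
    by rewrite -!mulmxA -rowE mxE !mulmxA -colE mxE.
  rewrite mxE raddf_sum /= => /eqP; rewrite psumr_eq0; last first.
    by move=> l _; rewrite !mxE; case: (\sum_j0 _) => a b /=; nra.
  move=> /allP/(_ j (mem_index_enum _)) /=; rewrite !mxE.
  case: (\sum_j0 _) => a b /=; rewrite mulNr opprK => /eqP ab.
  have -> : a = 0 by nra.
  by have -> : b = 0 by nra.
have vE : v = \sum_i (U *m v) i 0 *: (adj U *m delta_mx i 0).
  rewrite -{1}[v]mul1mx -(unit_mxV uU) -mulmxA {1}[U *m v]matrix_sum_delta.
  rewrite mulmx_sumr; apply: eq_bigr => i _.
  by rewrite big_ord1 -scalemxAr.
rewrite vE mulmx_sumr big1 // => i _; rewrite -scalemxAr.
case: (eqVneq (mu i) 0) => [/QU|mi].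
  by rewrite -!mulmxA => ->; rewrite mulmx0 scaler0.
suff -> : (U *m v) i 0 = 0 by rewrite scale0r.
have : diag_mx (\row_i (mu i)%:C%C) *m (U *m v) = 0.
  transitivity (U *m (sp U mu *m v)); last by rewrite hv mulmx0.
  by rewrite /sp !mulmxA uU mul1mx.
move/colP/(_ i); rewrite mul_diag_mx !mxE => /eqP; rewrite mulf_eq0 => /orP[|/eqP //].
by rewrite eq_complex /= (negbTE mi).
Qed.

(** Subsequences are extracted one sequence after another. The bound [n <= f n] is the part of
    monotonicity needed to pass to the limit. *)
Lemma bw_family (I : seq nat) (u : nat -> nat -> R) : (forall i n, `|u i n| <= 1) ->
  exists f : nat -> nat, (forall n, (n <= f n)%N) /\ forall i, i \in I -> cvgn (u i \o f).
Proof.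
move=> ub; elim: I => [|i I [f [fn fc]]]; first by exists id.
have [|g gi gc] := @bolzano_weierstrass R (u i \o f).
  exists 1; split; first exact: num_real.
  by move=> x x1 n _ /=; apply: le_trans (ub _ _) (ltW x1).
have gn n : (n <= g n)%N.
  elim: n => // n IH; apply: leq_ltn_trans IH _.
  by have := proj2 (increasing_seqP g) gi n; rewrite ltEnat.
exists (f \o g); split => [n|j].
  by apply: leq_trans (gn n) _; exact: fn.
rewrite inE => /orP[/eqP -> //|/fc jc].
have goo : g @ \oo --> \oo.
  by move=> A [N _ NA]; exists N => // n /= Nn; apply: NA => /=; exact: leq_trans (gn n).
by apply/cvg_ex; exists (limn (u j \o f)); exact: (@cvg_comp _ _ _ g (u j \o f) _ _ _ goo jc).
Qed.

Lemma density_entry k (s : 'M[C]_k) i j : density s ->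
  `|complex.Re (s i j)| <= 1 /\ `|complex.Im (s i j)| <= 1.
Proof.
move=> ds; have := rtr_density_sqr ds.
rewrite -{1}(psd_herm ds.1) /rtr raddf_sum /= => h.
have {h} : complex.Re (conjC (s i j) * s i j) <= 1.
  apply: le_trans h; rewrite (bigD1 j) //= ler_wpDr //.
    by apply: sumr_ge0 => l _; apply: Re_ge0; exact: gram_diag_ge0.
  rewrite mxE raddf_sum /= (bigD1 i) //= adjE ler_wpDr // sumr_ge0 // => l _.
  by rewrite adjE mulrC; apply/Re_ge0/mul_conjC_ge0.
case: (s i j) => a b /=; rewrite mulNr opprK => h.
split; rewrite -(ler_sqr (x := `|_|)) ?nnegrE // expr1n real_normK ?num_real // expr2; nra.
Qed.

(** Compactness applied to the real and imaginary parts of all entries together. That the limit is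
    again in the set of interest is left to closedness. *)
Lemma density_cvg k (t : nat -> 'M[C]_k) : (forall n, density (t n)) ->
  exists (f : nat -> nat) (t0 : 'M[C]_k), [/\ forall n, (n <= f n)%N,
   forall i j, (fun n => complex.Re (t (f n) i j)) @ \oo --> complex.Re (t0 i j) &
   forall i j, (fun n => complex.Im (t (f n) i j)) @ \oo --> complex.Im (t0 i j)].
Proof.
move=> dt; pose J : finType := ('I_k * 'I_k * bool)%type.
pose v (x : J) n := if x.2 then complex.Re (t n x.1.1 x.1.2) else complex.Im (t n x.1.1 x.1.2).
(* The coordinates are numbered by naturals; numbers out of range give the zero sequence. *)
pose u (i : nat) n := if insub i is Some i then v (enum_val (i : 'I_#|J|)) n else 0.
have ub i n : `|u i n| <= 1.
  rewrite /u; case: insubP => [x _ _|_]; last by rewrite normr0.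
  by rewrite /v; case: ifP => _; [exact: (density_entry _ _ (dt n)).1|exact: (density_entry _ _ (dt n)).2].
have [f [fn fc]] := bw_family (iota 0 #|J|) ub.
have vc (x : J) : cvgn (v x \o f).
  have -> : v x \o f = u (enum_rank x) \o f.
    apply/funext => n /=; rewrite /u insubT // => h.
    by rewrite (_ : Sub _ _ = enum_rank x) ?enum_rankK //; exact/val_inj.
  by apply: fc; rewrite mem_iota /=.
exists f, (\matrix_(i, j) (limn (v (i, j, true) \o f) +i* limn (v (i, j, false) \o f))%C).
split => // i j; rewrite mxE /=; first exact: (vc (i, j, true)).
exact: (vc (i, j, false)).
Qed.

Lemma rtr_mulE k (A G : 'M[C]_k) : rtr (A *m G) =
  \sum_i \sum_j (complex.Re (A i j) * complex.Re (G j i) - complex.Im (A i j) * complex.Im (G j i)).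
Proof.
rewrite /rtr raddf_sum; apply: eq_bigr => i _; rewrite /= mxE raddf_sum; apply: eq_bigr => j _ /=.
by case: (A i j) => a b; case: (G j i).
Qed.

Lemma cvg_sumR (I : Type) (l : seq I) (f : nat -> I -> R) (g : I -> R) :
  (forall i, f ^~ i @ \oo --> g i) ->
  (fun n => \sum_(i <- l) f n i) @ \oo --> \sum_(i <- l) g i.
Proof.
move=> h; elim: l => [|i l IH].
  by rewrite big_nil; under eq_fun do rewrite big_nil; exact: cvg_cst.
by rewrite big_cons; under eq_fun do rewrite big_cons; apply: cvgD.
Qed.

Lemma rtr_cvg k (t : nat -> 'M[C]_k) (t0 G : 'M[C]_k) :
  (forall i j, (fun n => complex.Re (t n i j)) @ \oo --> complex.Re (t0 i j)) ->
  (forall i j, (fun n => complex.Im (t n i j)) @ \oo --> complex.Im (t0 i j)) ->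
  (fun n => rtr (t n *m G)) @ \oo --> rtr (t0 *m G).
Proof.
move=> cR cI; rewrite rtr_mulE; under eq_fun do rewrite rtr_mulE.
apply: cvg_sumR => i; apply: cvg_sumR => j.
by apply: cvgB; apply: cvgM; [exact: cR|exact: cvg_cst|exact: cI|exact: cvg_cst].
Qed.

Lemma eig_density k (t V : 'M[C]_k) lam : density t -> unit_mx V -> t = sp V lam ->
  [/\ forall i, 0 <= lam i, \sum_i lam i = 1 & forall i, lam i <= 1].
Proof.
move=> dt uV et; have l0 i : 0 <= lam i by rewrite -(wt_sp lam i uV) -et; exact: (wt_ge0 _ _ dt.1).
have l1 : \sum_i lam i = 1 by rewrite -(rtr_sp0 _ uV) -et density_rtr.
by split => // i; rewrite -l1 (bigD1 i) //= lerDl sumr_ge0.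
Qed.

Lemma ln_add_ge (x e : R) : 0 <= x -> 0 < e -> x * ln x <= x * ln (x + e).
Proof.
rewrite le_eqVlt => /orP[/eqP <-|x0 e0]; first by rewrite !mul0r.
by rewrite ler_pM2l // ler_ln ?posrE ?addr_gt0 // lerDl ltW.
Qed.

Lemma ln_add_le (x e : R) : 0 < x -> 0 < e -> ln (x + e) <= ln x + e / x.
Proof.
move=> x0 e0; have -> : x + e = x * (1 + e / x) by field; rewrite gt_eqF.
rewrite lnM ?posrE ?addr_gt0 ?divr_gt0 // lerD2l; apply: le_ln1Dx.
by apply: lt_trans (_ : 0 < _) ; rewrite ?divr_gt0 // ltrN10.
Qed.

(** * Regularized logarithms and their removal by compactness *)

Section Regularization.
Variables (k' : nat).
Local Notation k := k'.+1.
Variables (S : set 'M[C]_k) (U : 'M[C]_k) (mu : 'I_k -> R).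
Hypothesis Sdens : forall t, S t -> density t.
Hypothesis Sclosed : mx_closed S.
Hypothesis uU : unit_mx U.
Hypothesis mu01 : forall i, 0 <= mu i <= 1.

(** Eigenvalue of the state mixed with the identity and renormalized: it is positive and the total
    mass stays 1, so Klein's inequality applies to it. *)
Definition reg (e x : R) : R := (x + e) / (1 + k%:R * e).

Lemma den_gt0 (e : R) : 0 < e -> 0 < 1 + k%:R * e.
Proof. by move=> e0; apply: ltr_wpDr => //; rewrite mulr_ge0 // ltW. Qed.

Lemma reg_gt0 (e x : R) : 0 <= x -> 0 < e -> 0 < reg e x.
Proof. by move=> x0 e0; apply: divr_gt0; [exact: ltr_wpDl|exact: den_gt0]. Qed.

Lemma sum_reg (e : R) (lam : 'I_k -> R) : 0 < e -> \sum_i lam i = 1 -> \sum_i reg e (lam i) = 1.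
Proof.
move=> e0 l1; rewrite /reg -mulr_suml big_split /= l1 sumr_const card_ord -(mulr_natl e).
by rewrite mulfV // gt_eqF // den_gt0.
Qed.

Lemma ln_reg (e x : R) : 0 <= x -> 0 < e -> ln (reg e x) = ln (x + e) - ln (1 + k%:R * e).
Proof.
by move=> x0 e0; rewrite ln_div // posrE ?den_gt0 // ltr_wpDl.
Qed.

Lemma ln_reg_le (e : R) : 0 < e -> ln (1 + k%:R * e) <= k%:R * e.
Proof. by move=> e0; apply: le_ln1Dx; apply: lt_le_trans (ltrN10 _) _; rewrite mulr_ge0 // ltW. Qed.

(** Adding [e] inside the logarithm can only increase the mean, and the normalization costs at most
    [k%:R * e]. *)
Lemma mean_reg_ge (e : R) (lam : 'I_k -> R) : 0 < e -> (forall i, 0 <= lam i) -> \sum_i lam i = 1 ->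
  mean lam (fun i => ln (lam i)) - k%:R * e <= mean lam (fun i => ln (reg e (lam i))).
Proof.
move=> e0 l0 l1.
have -> : mean lam (fun i => ln (reg e (lam i))) =
    mean lam (fun i => ln (lam i + e)) - ln (1 + k%:R * e).
  rewrite -[ln (1 + _)](mean_cst _ l1) -mulN1r -meanZ -meanD; apply: eq_mean => i.
  by rewrite ln_reg // mulN1r.
apply: lerB; last exact: ln_reg_le.
by apply: ler_sum => i _; exact: ln_add_ge.
Qed.

(* The regularized divergence is bounded below on [S] by any number below the infimum of the
   divergence: otherwise a limit point of minimizers, through Klein's inequality, would have
   a divergence at most [L]. *)
Lemma regularized_bound (L : R) :
  (forall t, S t -> (forall i, mu i = 0 -> wt U t i = 0) ->
    L < mean (eig t) (fun i => ln (eig t i)) - mean (wt U t) (fun i => ln (mu i))) ->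
  exists2 e, 0 < e <= 1 & forall t V lam, S t -> unit_mx V -> t = sp V lam ->
    L <= mean lam (fun i => ln (reg e (lam i))) - mean (wt U t) (fun i => ln (mu i + e)).
Proof.
move=> hL; apply: contrapT => /forall2NP H.
pose e n : R := n.+1%:R^-1.
have e0 n : 0 < e n by rewrite invr_gt0 ltr0n.
have e1 n : e n <= 1 by rewrite invf_le1 ?ltr0n // ler1n.
have H1 n : exists t, S t /\ exists V lam, [/\ unit_mx V, t = sp V lam &
    mean lam (fun i => ln (reg (e n) (lam i))) - mean (wt U t) (fun i => ln (mu i + e n)) < L].
  have [|] := H (e n); first by rewrite e0 e1.
  move=> /existsNP[t /existsNP[V /existsNP[lam /not_implyP[St /not_implyP[uV /not_implyP[et /negP]]]]]].
  by rewrite -ltNge => h; exists t; split => //; exists V, lam.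
have [t Ht] := choice H1.
have St n : S (t n) by case: (Ht n).
have [f [t0 [fn cR cI]]] := density_cvg (fun n => Sdens (St n)).
have St0 : S t0 by apply: (Sclosed (u := t \o f)) => // n; exact: St.
have dt0 := Sdens St0.
have [] := herm_spectral (psd_herm dt0.1); set W := spectralmx t0; set nu := eig t0 => uW et0 _.
have [nu0 nu1 nu_1] := eig_density dt0 uW et0.
pose q := wt U t0.
have [q0 q1] := density_wt uU dt0.
(* For fixed [j] the functional [G] is linear, so it passes to the limit along the subsequence.
   Klein's inequality bounds it by the entropy term of [t (f n)]; one error [k%:R * e j] comes from
   that regularization and one from regularizing [t0]. *)
have K j : mean nu (fun i => ln (nu i)) - mean q (fun i => ln (mu i + e j)) <= L + 2 * (k%:R * e j).
  pose G := sp W (fun i => ln (reg (e j) (nu i))) - sp U (fun i => ln (mu i + e j)).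
  have GE s : rtr (s *m G) = mean (wt W s) (fun i => ln (reg (e j) (nu i))) -
      mean (wt U s) (fun i => ln (mu i + e j)).
    by rewrite /G mulmxBr rtrB !rtr_sp.
  have bd : rtr (t0 *m G) <= L + k%:R * e j.
    have cG := @rtr_cvg _ (fun n => t (f n)) t0 G cR cI; rewrite -(cvg_lim _ cG) //.
    apply: limr_le; first by apply/cvg_ex; exists (rtr (t0 *m G)).
    exists j => // n /= jn; have [_ [V [lam [uV et h]]]] := Ht (f n).
    have jfn : (j <= f n)%N := leq_trans jn (fn n).
    have ejn : e (f n) <= e j by rewrite lef_pV2 ?posrE ?ltr0n // ler_nat.
    have [l0 l1 _] := eig_density (Sdens (St (f n))) uV et.
    have [p0 p1] := density_wt uU (Sdens (St (f n))).
    rewrite GE.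
    have kl : mean (wt W (t (f n))) (fun i => ln (reg (e j) (nu i))) <= mean lam (fun i => ln (lam i)).
      rewrite et; apply: klein => // [i|]; first exact: reg_gt0.
      by rewrite sum_reg.
    have h2 := mean_reg_ge (e0 (f n)) l0 l1.
    have h3 : mean (wt U (t (f n))) (fun i => ln (mu i + e (f n))) <=
        mean (wt U (t (f n))) (fun i => ln (mu i + e j)).
      apply: ler_mean => // i; have /andP[m0 _] := mu01 i.
      by rewrite ler_ln ?posrE ?ltr_wpDl // lerD2l.
    have h4 : k%:R * e (f n) <= k%:R * e j by rewrite ler_wpM2l.
    by move: kl h2 h3 h4 h; lra.
  rewrite GE -/q in bd.
  have := mean_reg_ge (e0 j) nu0 nu1.
  have <- : mean (wt W t0) (fun i => ln (reg (e j) (nu i))) = mean nu (fun i => ln (reg (e j) (nu i))).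
    by apply: eq_bigr => i _; rewrite {1}et0 wt_sp.
  by move: bd; lra.
have small (c b : R) : (forall j, c <= b * e j) -> c <= 0.
  move=> h; rewrite leNgt; apply/negP => c0.
  have bc : 0 <= `|b| / c by rewrite divr_ge0 // ltW.
  have := archi_boundP bc; set N := Num.bound _; rewrite ltr_pdivrMr // => hN.
  have := le_trans (h N) (ler_wpM2r (ltW (e0 N)) (ler_norm b)).
  rewrite leNgt => /negP; apply; rewrite ltr_pdivrMr ?ltr0n //.
  by apply: lt_le_trans hN _; rewrite mulrC ler_pM2l // ler_nat.
(* If the support of the limit is contained in that of the second state, letting [e j] tend to 0 in
   [K] contradicts [hL]. Otherwise a zero eigenvalue has positive weight [q i], and [K] would bound
   [ln (e j)] below. *)
have [supp|/existsNP[i /not_implyP[mi qi]]] := pselect (forall i, mu i = 0 -> q i = 0).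
  have := hL _ St0 supp; rewrite -/nu; rewrite -/q; set A := _ - _ => LA.
  have : A - L <= 0.
    apply: (small _ (2 * k%:R + \sum_i q i / mu i)) => j.
    have : mean q (fun i => ln (mu i + e j)) <=
        mean q (fun i => ln (mu i)) + (\sum_i q i / mu i) * e j.
      rewrite mulr_suml -big_split; apply: ler_sum => i _ /=.
      case: (eqVneq (mu i) 0) => [/supp ->|mi]; first by rewrite !mul0r addr0.
      have mp : 0 < mu i by rewrite lt_neqAle eq_sym mi; case/andP: (mu01 i).
      rewrite -mulrA -mulrDr; apply: ler_wpM2l; first exact: q0.
      by rewrite [_^-1 * _]mulrC; exact: ln_add_le.
    by move: (K j); rewrite /A; lra.
  by rewrite subr_le0 leNgt LA.
have qi0 : 0 < q i by rewrite lt_neqAle eq_sym q0 andbT; exact/eqP.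
have : exists B, forall j, B <= ln (e j).
  pose A := mean nu (fun i => ln (nu i)).
  exists ((A - L - 2 * k%:R - 1) / q i) => j; rewrite ler_pdivrMr //.
  have : mean q (fun i => ln (mu i + e j)) <= ln (e j) * q i + 1.
    rewrite /mean (bigD1 i) //= mi add0r mulrC lerD2l.
    apply: (@le_trans _ _ (\sum_(l | l != i) q l)).
      apply: ler_sum => l _; rewrite -[leRHS]mulr1; apply: ler_wpM2l => //.
      have /andP[m0 m1] := mu01 l.
      have : ln (1 + (mu l + e j - 1)) <= mu l + e j - 1.
        by apply: le_ln1Dx; rewrite ltrBrDr addNr ltr_wpDl.
      by rewrite addrC subrK => h; apply: le_trans h _; move: (e1 j) m1; lra.
    by rewrite -q1 [leRHS](bigD1 i) //= lerDr ltW.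
  have ke : k%:R * e j <= k%:R by rewrite -[leRHS]mulr1 ler_wpM2l.
  by move: (K j); rewrite -/A; move: ke; lra.
case=> B hB; have : expR B <= 0.
  by apply: (small _ 1) => j; rewrite mul1r -[leRHS]lnK ?posrE // ler_expR.
by rewrite leNgt expR_gt0.
Qed.

End Regularization.

End Entropy.

(** * Hypothesis testing and relative entropy in terms of spectral data *)

Section Assembly.
Variable R : realType.
Local Notation C := (R[i]).

Lemma hyptest_le k eps (s rho M : 'M[C]_k) : psdmx rho -> test M ->
  rtr ((1%:M - M) *m s) <= eps -> hyptest_min eps s rho <= rtr (M *m rho).
Proof.
move=> pr [pM pM'] h; apply: ge_inf; last by exists M; split.
exists 0 => _ [N [pN pN' _ ->]]; exact: rtr_psdM_ge0.
Qed.

Lemma hyptest_ge k eps (s rho : 'M[C]_k) B : 0 <= eps ->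
  (forall M, test M -> rtr ((1%:M - M) *m s) <= eps -> B <= rtr (M *m rho)) ->
  B <= hyptest_min eps s rho.
Proof.
move=> e0 h; apply: lb_le_inf.
  exists (rtr (1%:M *m rho)), 1%:M; split; [exact: psd1|by rewrite subrr; exact: psd0| |by []].
  by rewrite subrr mul0mx mxtrace0.
by move=> _ [N [pN pN' hN ->]]; apply: h.
Qed.

Lemma hyptest_ge0 k eps (s rho : 'M[C]_k) : 0 <= eps -> psdmx rho -> 0 <= hyptest_min eps s rho.
Proof. by move=> e0 pr; apply: hyptest_ge => // M tM _; exact: rtr_test_ge0. Qed.

Lemma DH_ge k eps (s rho : 'M[C]_k) (x : R) : 0 <= eps -> psdmx rho ->
  hyptest_min eps s rho <= expR (- x) -> (x%:E <= DH eps s rho)%E.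
Proof.
move=> e0 pr h; rewrite /DH; case: eqVneq => [_|n0]; first exact: leey.
have b0 : 0 < hyptest_min eps s rho by rewrite lt_neqAle eq_sym n0 hyptest_ge0.
by rewrite lee_fin lerNr -[leRHS](expRK (- x)) ler_ln ?posrE ?expR_gt0.
Qed.

Lemma DH_le k eps (s rho : 'M[C]_k) (x : R) :
  expR (- x) <= hyptest_min eps s rho -> (DH eps s rho <= x%:E)%E.
Proof.
move=> h; have b0 := lt_le_trans (expR_gt0 _) h; rewrite /DH gt_eqF //.
by rewrite lee_fin lerNl -[leLHS](expRK (- x)) ler_ln ?posrE ?expR_gt0.
Qed.

(** Only real thresholds are used, so an infinite limit needs no separate estimate: for [D] equal to
    [+oo] the second hypothesis is vacuous. *)
Lemma ereal_cvg_squeeze (u : nat -> \bar R) (D : \bar R) :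
  (forall a : R, (a%:E < D)%E -> \forall n \near \oo, (a%:E <= u n)%E) ->
  (forall a : R, (D < a%:E)%E -> \forall n \near \oo, (u n <= a%:E)%E) ->
  u @ \oo --> D.
Proof.
case: D => [x| |] lo hi A /=.
- case=> e /= e0 eA.
  have h1 : ((x - e / 2)%:E < x%:E)%E by rewrite lte_fin ltrBlDr ltrDl divr_gt0.
  have h2 : (x%:E < (x + e / 2)%:E)%E by rewrite lte_fin ltrDl divr_gt0.
  change (\forall n \near \oo, A (u n)); near=> n; have : ((x - e / 2)%:E <= u n)%E by near: n; exact: lo.
  have : (u n <= (x + e / 2)%:E)%E by near: n; exact: hi.
  case: (u n) => [y| |] //; rewrite !lee_fin => h3 h4; apply: eA => /=.
  by rewrite ltr_norml; apply/andP; split; lra.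
- case=> M [_ MA]; change (\forall n \near \oo, A (u n)); near=> n; apply: MA.
  have : ((M + 1)%:E <= u n)%E by near: n; apply: lo; exact: ltry.
  by apply: lt_le_trans; rewrite lte_fin ltrDl.
- case=> M [_ MA]; change (\forall n \near \oo, A (u n)); near=> n; apply: MA.
  have : (u n <= (M - 1)%:E)%E by near: n; apply: hi; exact: ltNyr.
  by move=> h; apply: le_lt_trans h _; rewrite lte_fin ltrBlDr ltrDl.
Unshelve. all: by end_near.
Qed.

Variable d' : nat.
Local Notation d := d'.+1.

Lemma psd_tpow (rho : 'M[C]_d) n : psdmx rho -> psdmx (tpow rho n).
Proof.
case/psd_spectral => U [mu [uU -> m0]]; rewrite /tpow ntens_sp; apply: psd_sp => x.
exact: prodr_ge0.
Qed.

Lemma density_tpow (rho : 'M[C]_d) n : density rho -> rtr (tpow rho n) = 1.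
Proof.
move=> dr; have [U [mu [uU er m0]]] := psd_spectral dr.1.
rewrite er /tpow ntens_sp rtr_sp0 ?big_dig; last exact: unit_ntens.
by rewrite -(rtr_sp0 mu uU) -er density_rtr // expr1n.
Qed.

Lemma relentE (s rho : 'M[C]_d) : psdmx s -> psdmx rho ->
  relent s rho = if `[< forall i, eig rho i = 0 -> wt (spectralmx rho) s i = 0 >]
    then (mean (eig s) (fun i => ln (eig s i)) -
          mean (wt (spectralmx rho) s) (fun i => ln (eig rho i)))%:E else +oo%E.
Proof.
move=> ps pr.
have [uV es fs] := herm_spectral (psd_herm ps).
have [uU er fr] := herm_spectral (psd_herm pr).
rewrite /relent.
have -> : `[< forall v : 'cV[C]_d, rho *m v = 0 -> s *m v = 0 >] =
    `[< forall i, eig rho i = 0 -> wt (spectralmx rho) s i = 0 >].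
  by apply: asbool_equiv_eq; rewrite {1}er; exact: sp_kerP uU ps.
case: ifP => // _; congr EFin.
rewrite fs fr -[complex.Re _]/(rtr _) mulmxBr rtrB !rtr_sp; congr (_ - _).
by apply: eq_bigr => i _; rewrite {2}es wt_sp.
Qed.

Lemma near_nat_ge (N : nat) (P : nat -> Prop) : (forall n, (N <= n)%N -> P n) ->
  \forall n \near \oo, P n.
Proof. by move=> h; exists N. Qed.

End Assembly.

(** * Scalar inequalities for the conditioning argument *)

Section Numeric.
Variable R : realType.

(* For outcome probabilities [p0], [p1] and conditional means [T0], [T1] of an observable whose
   covariance with the measured one is [ka - mu0 * mum]; [p0 * p1 * Z] is the gain of purity. *)
Lemma energy_gain (p0 p1 T0 T1 Z sg mu0 mum ka D : R) :
  p0 = (1 + sg * mu0) / 2 -> p1 = (1 - sg * mu0) / 2 -> 0 <= p0 -> 0 <= p1 ->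
  p0 * T0 = (mum + sg * ka) / 2 -> p1 * T1 = (mum - sg * ka) / 2 ->
  (T0 - T1) ^+ 2 <= D * Z ->
  sg ^+ 2 * (ka - mu0 * mum) ^+ 2 <= D * (p0 * p1 * Z).
Proof.
move=> e0 e1 h0 h1 t0 t1 hD; set q := p0 * p1.
have q0 : 0 <= q by exact: mulr_ge0.
have qT : q * (T0 - T1) = sg / 2 * (ka - mu0 * mum).
  by rewrite /q mulrBr {1}(mulrC p0) -!mulrA t0 t1 e0 e1; field.
have q4 : 4 * q <= 1.
  have : 0 <= (p0 - p1) ^+ 2 by exact: sqr_ge0.
  have -> : (p0 - p1) ^+ 2 = 1 - 4 * q by rewrite /q e0 e1; field.
  by rewrite subr_ge0.
apply: (@le_trans _ _ (4 * q * (q * (T0 - T1) ^+ 2))).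
  rewrite le_eqVlt; apply/orP; left; apply/eqP.
  transitivity (4 * (q * (T0 - T1)) ^+ 2); last by ring.
  by rewrite qT; field.
apply: (@le_trans _ _ (1 * (q * (T0 - T1) ^+ 2))).
  by apply: ler_wpM2r => //; rewrite mulr_ge0 // sqr_ge0.
by rewrite mul1r [leRHS]mulrCA; exact: ler_wpM2l.
Qed.

Lemma cov_tail (k x y gam c2 : R) : 0 < k -> gam * (1 + k) < x + k * y ->
  c2 <= gam / 2 * k -> x <= c2 -> 0 <= gam -> gam / 2 <= y.
Proof. by move=> k0 h hm c1 g0; rewrite -(ler_pM2l k0); lra. Qed.

Lemma mix_sum (x y k q : R) : x <= y + k -> q <= y + q + k - x.
Proof. by move=> h; lra. Qed.

Lemma energy_sum (k x y z w : R) : k *+ 2 <= y + z + w - x -> w <= k -> x + k <= y + z.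
Proof. by rewrite mulr2n => h1 h2; lra. Qed.

Lemma err_sum (p0 p1 x y t c e k kap : R) : p0 + p1 = 1 -> 0 <= e ->
  t + kap <= p0 * x + p1 * y ->
  p0 * (c + e * (1 - x) - k * (e * kap)) + p1 * (c + e * (1 - y) - k * (e * kap)) <=
  c + e * (1 - t) - (k + 1) * (e * kap).
Proof.
move=> p1E e1 h; have := ler_wpM2l e1 h.
have -> : p1 = 1 - p0 by lra.
by move=> H; lra.
Qed.

Lemma abs_ln_le (x y z : R) : 0 < x -> x <= y -> y <= z -> `|ln y| <= `|ln x| + `|ln z|.
Proof.
move=> x0 xy yz; have y0 := lt_le_trans x0 xy; have z0 := lt_le_trans y0 yz.
have h1 : ln x <= ln y by rewrite ler_ln ?posrE.
have h2 : ln y <= ln z by rewrite ler_ln ?posrE.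
rewrite ler_norml; apply/andP; split.
  by rewrite lerNl; apply: (@le_trans _ _ (- ln x));
    rewrite ?lerN2 // (le_trans (ler_norm _)) // normrN lerDl.
by apply: le_trans h2 _; rewrite (le_trans (ler_norm _)) // lerDr.
Qed.

Lemma one_add_gel (x y : R) : 0 <= y -> x <= 1 + x + y.
Proof. by move=> h; lra. Qed.

Lemma one_add_ger (x y : R) : 0 <= x -> y <= 1 + x + y.
Proof. by move=> h; lra. Qed.

End Numeric.

(** * Conditioning on compatible measurements *)

Section Conditioning.
Variables (R : realType) (d' : nat).
Local Notation C := (R[i]).
Local Notation d := d'.+1.
Variables (F : forall n : nat, set 'M[C]_(d ^ n)) (r : nat -> R).
Arguments F : clear implicits.
Hypothesis convF : mx_convex (F 1%N).
Hypothesis closedF : mx_closed (F 1%N).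
Hypothesis densF : forall n, (0 < n)%N -> forall s, F n s -> density s.
Hypothesis tensF : forall n m, (0 < n)%N -> (0 < m)%N ->
  forall s s', F n s -> F m s' -> F (n + m)%N (tens s s').
Hypothesis permF : forall n, (0 < n)%N -> forall (pi : 'S_n) s,
  F n s -> F n (perm_op R d pi *m s *m adj (perm_op R d pi)).
Hypothesis r01 : forall n, (0 < n)%N -> 0 < r n <= 1.
Hypothesis compatF : forall n m, (0 < n)%N -> (0 < m)%N ->
  forall X : 'M[C]_(d ^ n), X \is hermsymmx -> opnorm X <= r n ->
  forall (b : bool) (s : 'M[C]_(d ^ (n + m))), F (n + m)%N s ->
  mx_cone (F m)
    (@trace_firsts R d n m
      (tens ((2 : C)^-1 *: (1%:M + (-1) ^+ b *: X)) (1%:M : 'M[C]_(d ^ m)) *m s)).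

Definition effect (b : bool) (t : R) : R := (1 + (-1) ^+ b * t) / 2.

(** The compatibility condition in dual form: [l] is the probability of the outcome and [t] the
    conditional state of the remaining sites, both seen through expectations. *)
Lemma cond_state n m (U : 'M[C]_(d ^ n)) (h : 'I_(d ^ n) -> R) b (s : 'M[C]_(d ^ (n + m))) :
  (0 < n)%N -> (0 < m)%N -> unit_mx U -> (forall i, `|h i| <= r n) -> F (n + m)%N s ->
  exists l t, [/\ 0 <= l, F m t & forall B,
    l * rtr (B *m t) = rtr (tens (sp U (fun i => effect b (h i))) B *m s)].
Proof.
move=> n0 m0 uU hr Fs.
have hX : sp U h \is hermsymmx by apply/adj_hermP; exact: adj_sp.
have /andP[rn0 _] := r01 n0.
have := compatF n0 m0 hX (opnorm_sp uU (ltW rn0) hr) b Fs.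
have -> : (2 : C)^-1 *: (1%:M + (-1) ^+ b *: sp U h) = sp U (fun i => effect b (h i)).
  have -> : (2 : C)^-1 = ((2 : R)^-1%:C)%C by rewrite fmorphV rmorph_nat.
  have -> : (-1) ^+ b = (((-1) ^+ b : R)%:C)%C by case: b; rewrite ?rmorphN ?rmorph1.
  rewrite spZ -(sp1 uU) spD spZ; apply: eq_sp => i.
  by rewrite /effect mulrC.
case=> l l0 [t Ft e]; exists l, t; split => // B.
rewrite -rtrZ scalemxAr -e (rtrC B).
have Z := congr1 (@complex.Re R)
  (tr_trace_firsts (tens (sp U (fun i => effect b (h i))) 1%:M *m s) B).
rewrite -!/(rtr _) in Z; by rewrite Z rtrC mulmxA tensM mul1mx mulmx1.
Qed.

Lemma rtr_tens_sp n m (U : 'M[C]_d) g h f (s : 'M[C]_(d ^ (n + m))) :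
  (forall x y, f (cati x y) = g x * h y) ->
  rtr (tens (sp (ntensmx U n) g) (sp (ntensmx U m) h) *m s) = mean (dwt U s) f.
Proof. by move=> e; rewrite (tens_sp _ _ e) -ntensD rtr_sp_mul. Qed.

Lemma mean_perm n (pi : 'S_n) (U : 'M[C]_d) (s : 'M[C]_(d ^ n)) f f' :
  (forall x, f x = f' (pidx pi x)) ->
  mean (dwt U (perm_op R d pi *m s *m adj (perm_op R d pi))) f = mean (dwt U s) f'.
Proof.
move=> e; rewrite /mean [RHS](reindex_inj (@pidx_inj _ _ pi)).
by apply: eq_bigr => x _; rewrite e /dwt wt_perm.
Qed.

(** Compatibility with [X = 0] is a partial trace up to the factor 1/2. Moving site [k] to the last
    place first yields its marginal, and the trace condition fixes [l]. *)
Lemma site_state N n (k : 'I_N) (s : 'M[C]_(d ^ N)) : N = (n + 1)%N -> F N s ->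
  exists2 t : 'M[C]_(d ^ 1), F 1%N t & forall (U : 'M[C]_d) g, unit_mx U ->
    rtr ((sp U g : 'M[C]_(d ^ 1)) *m t) = mean (dwt U s) (fun x => g (dig x k)).
Proof.
move=> eN; subst N => Fs; case: n k s Fs => [|n] k s Fs.
  exists s => // U g uU; rewrite rtr_sp_mul; apply: eq_bigr => x _.
  by rewrite dig1.
pose last := rshift n.+1 (ord0 : 'I_1).
have h0 : forall i : 'I_(d ^ n.+1), `|(fun=> 0 : R) i| <= r n.+1.
  by move=> i; rewrite normr0; have /andP[/ltW] := r01 (isT : (0 < n.+1)%N).
have u1 : unit_mx (1%:M : 'M[C]_(d ^ n.+1)) by rewrite /unit_mx adj1 mulmx1.
have N0 : (0 < n.+1 + 1)%N by [].
have := permF N0 (tperm k last) Fs; set s' := _ *m s *m _ => Fs'.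
have [l [t [l0 Ft tE]]] := cond_state false (isT : (0 < n.+1)%N) (isT : (0 < 1)%N) u1 h0 Fs'.
have e0 (W : 'M[C]_(d ^ n.+1)) : unit_mx W ->
    sp W (fun=> effect false 0) = ((2 : R)^-1%:C)%C *: 1%:M.
  by move=> uW; rewrite -(sp1 uW) spZ; apply: eq_sp => i; rewrite /effect mulr0 addr0 mulr1 mul1r.
rewrite (e0 _ u1) in tE.
have tE' B : l * rtr (B *m t) = 2^-1 * rtr (tens (1%:M : 'M[C]_(d ^ n.+1)) B *m s').
  by rewrite tE -rtrZ scalemxAl; congr (rtr (_ *m _)); apply: matrix_catiP => x y x' y';
    rewrite mxE !tensE mxE mulrA.
have lE : l = 2^-1.
  have := tE' 1%:M; rewrite mul1mx tens1 mul1mx !density_rtr ?mulr1 //; first exact: densF Fs'.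
  exact: densF Ft.
exists t => // U g uU.
have -> : rtr ((sp U g : 'M[C]_(d ^ 1)) *m t) = rtr (tens (1%:M : 'M[C]_(d ^ n.+1)) (sp U g : 'M[C]_(d ^ 1)) *m s').
  by apply: (mulfI (_ : 2^-1 != 0 :> R)); [rewrite invr_eq0 pnatr_eq0 | rewrite -tE' lE].
pose f (z : 'I_(d ^ (n.+1 + 1))) := g (dig z last).
have -> : rtr (tens (1%:M : 'M[C]_(d ^ n.+1)) (sp U g : 'M[C]_(d ^ 1)) *m s') = mean (dwt U s') f.
  rewrite -(sp1 (unit_ntens n.+1 uU)) -[sp U g]/(@sp R (d ^ 1) (ntensmx U 1) g).
  by apply: rtr_tens_sp => x y; rewrite /f dig_catr dig1 mul1r.
apply: mean_perm => x; rewrite /f dig_pidx tpermL //.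
Qed.

(* [t] is the average of the one-site marginals of [s], expressed by expectations of diagonal
   observables in every basis. *)
Definition is_marg n (s : 'M[C]_(d ^ n)) (t : 'M[C]_(d ^ 1)) := forall (U : 'M[C]_d) g,
  unit_mx U -> ip (sp U g : 'M[C]_(d ^ 1)) t = mean (dwt U s) (davg g).

Lemma convex_avg n (G : 'I_n.+1 -> 'M[C]_(d ^ 1)) : (forall k, F 1%N (G k)) ->
  exists2 t, F 1%N t & forall B, ip B t = n.+1%:R^-1 * \sum_k ip B (G k).
Proof.
elim: n G => [|n IH] G FG.
  by exists (G ord0) => // B; rewrite invr1 mul1r big_ord1.
have [t Ft tE] := IH (fun k => G (lift ord0 k)) (fun k => FG _).
have nz : (n.+2%:R : R) != 0 by rewrite pnatr_eq0.
have nz1 : (n.+1%:R : R) != 0 by rewrite pnatr_eq0.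
pose c : R := n.+2%:R^-1; have c01 : 0 <= c <= 1.
  by rewrite invr_ge0 ler0n invf_le1 ?ltr0n // ler1n.
exists ((c%:C)%C *: G ord0 + ((1 - c)%:C)%C *: t); first exact: convF.
move=> B; rewrite ipDr !ipZr tE [in RHS]big_ord_recl.
move: (\sum_(i < n.+1) _) (ip B (G ord0)) => S x; rewrite /c.
move: nz nz1; rewrite (_ : n.+2%:R = n.+1%:R + 1 :> R); last by rewrite -natr1.
move: (n.+1%:R : R) => y nz nz1.
by field; rewrite nz nz1.
Qed.

Lemma marg_state n (s : 'M[C]_(d ^ n)) : (0 < n)%N -> F n s ->
  exists2 t : 'M[C]_(d ^ 1), F 1%N t & is_marg s t.
Proof.
case: n s => // n s _ Fs.
have H k : exists t : 'M[C]_(d ^ 1), F 1%N t /\ forall (U : 'M[C]_d) g, unit_mx U ->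
    rtr ((sp U g : 'M[C]_(d ^ 1)) *m t) = mean (dwt U s) (fun x => g (dig x k)).
  by have [|t Ft tE] := @site_state n.+1 n k s _ Fs; [rewrite addn1|exists t].
have [G HG] := choice H.
have [t Ft tE] := convex_avg (fun k => (HG k).1).
exists t => // U g uU; rewrite tE meanZ mean_sum; congr (_ * _).
by apply: eq_bigr => k _; exact: (HG k).2.
Qed.

Lemma is_marg_perm n (pi : 'S_n) (s : 'M[C]_(d ^ n)) t : is_marg s t ->
  is_marg (perm_op R d pi *m s *m adj (perm_op R d pi)) t.
Proof.
move=> h U g uU; rewrite (h U g uU); apply/esym/mean_perm => x.
rewrite /davg; congr (_ * _); rewrite (reindex_inj (@perm_inj _ pi)).
by apply: eq_bigr => k _; rewrite dig_pidx.
Qed.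

(** Pigeonhole: covariance is linear in its first argument, so the covariance of the average is the
    average of the one-site covariances. *)
Lemma site_cov n (w : 'I_(d ^ n) -> R) (g : 'I_d -> R) (h : 'I_(d ^ n) -> R) c :
  (0 < n)%N -> c < cov w (davg g) h -> exists k, c < cov w (fun x => g (dig x k)) h.
Proof.
move=> n0; apply: contraPP => /forallNP H; apply/negP; rewrite -leNgt.
rewrite /davg covZl cov_suml mulrC ler_pdivrMr ?ltr0n // mulr_natr -[n in leRHS]card_ord -sumr_const.
by apply: ler_sum => k _; have /negP := H k; rewrite -leNgt.
Qed.

Definition tavg m (h : 'I_d -> R) (z : 'I_(d ^ (1 + m))) : R :=
  m%:R^-1 * \sum_(k < m) h (dig z (rshift 1 k)).

Definition hval m (h : 'I_d -> R) (z : 'I_(d ^ (1 + m))) : R := h (dig z (lshift m ord0)).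

Lemma tavg_cati m h (x : 'I_(d ^ 1)) (y : 'I_(d ^ m)) : tavg h (cati x y) = davg h y.
Proof. by congr (_ * _); apply: eq_bigr => k _; rewrite dig_catr. Qed.

Lemma hval_cati m h (x : 'I_(d ^ 1)) (y : 'I_(d ^ m)) : hval h (cati x y) = h x.
Proof. by rewrite /hval dig_catl dig1. Qed.

Lemma davg_head m h (z : 'I_(d ^ (1 + m))) : (0 < m)%N ->
  davg h z = (1 + m%:R)^-1 * (hval h z + m%:R * tavg h z).
Proof.
move=> m0; rewrite /davg big_split_ord big_ord1 natrD /tavg mulVKf //.
by rewrite pnatr_eq0 -lt0n.
Qed.

Lemma effectD t : effect false t + effect true t = 1.
Proof. by rewrite /effect expr0 expr1; field. Qed.

Lemma mean_effect (I : finType) (w g h : I -> R) b a :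
  mean w (fun x => effect b (a * g x) * h x) =
  (mean w h + (-1) ^+ b * a * mean w (fun x => g x * h x)) / 2.
Proof.
rewrite (@eq_mean _ _ w _ (fun x => 2^-1 * (h x + (-1) ^+ b * a * (g x * h x)))).
  by rewrite meanZ meanD meanZ mulrC.
by move=> x; rewrite /effect; field.
Qed.

(** * One conditioning step: measuring the first site *)

Section Step.
Variables (m : nat) (s : 'M[C]_(d ^ (1 + m))) (U : 'M[C]_d) (g : 'I_d -> R) (a : R).
Hypothesis m0 : (0 < m)%N.
Hypothesis Fs : F (1 + m)%N s.
Hypothesis uU : unit_mx U.
(** For each outcome, [p] is its probability, [u] the conditional state of the other [m] sites, and
    [v] the average one-site marginal of [u]. *)
Variables (p : bool -> R) (u : bool -> 'M[C]_(d ^ m)) (v : bool -> 'M[C]_(d ^ 1)).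
Let E b : 'M[C]_(d ^ 1) := sp U (fun i => effect b (a * g i)).
Hypothesis p0 : forall b, 0 <= p b.
Hypothesis Fu : forall b, F m (u b).
Hypothesis Fv : forall b, F 1%N (v b).
Hypothesis uv : forall b, is_marg (u b) (v b).
Hypothesis pu : forall b B, p b * rtr (B *m u b) = rtr (tens (E b) B *m s).

Let w := dwt U s.
Let tau := ((p false)%:C)%C *: v false + ((p true)%:C)%C *: v true.

Lemma sumE : E false + E true = 1%:M.
Proof. by rewrite /E spD -(sp1 uU); apply: eq_sp => i; exact: effectD. Qed.

Lemma mean_branch (b : bool) (h : 'I_d -> R) :
  p b * ip (sp U h : 'M[C]_(d ^ 1)) (v b) =
  (mean w (tavg h) + (-1) ^+ b * a * mean w (fun x => hval g x * tavg h x)) / 2.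
Proof.
rewrite uv // -mean_effect mean_dwt pu.
apply: (@rtr_tens_sp 1 m) => x y.
by rewrite hval_cati tavg_cati.
Qed.

Lemma branch_prob b : p b = (1 + (-1) ^+ b * a * mean w (hval g)) / 2.
Proof.
have [w0 w1] := dwt_density uU (densF (isT : (0 < 1 + m)%N) Fs).
have := pu b 1%:M; rewrite mul1mx density_rtr ?mulr1; last exact: densF (Fu b).
move=> ->; rewrite -(sp1 (unit_ntens m uU)).
rewrite (@rtr_tens_sp 1 m U _ _ (fun x => effect b (a * hval g x) * 1)).
  rewrite mean_effect mean_cst //; congr ((1 + _ * _) / 2).
  by apply: eq_mean => x; rewrite mulr1.
by move=> x y; rewrite hval_cati.
Qed.

(** The two effects sum to the identity, so forgetting the outcome recovers the unconditioned state:
    [tau] is the average marginal of the last [m] sites of [s]. *)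
Lemma branch_mix (V : 'M[C]_d) h : unit_mx V ->
  ip (sp V h : 'M[C]_(d ^ 1)) tau = mean (dwt V s) (tavg h).
Proof.
move=> uV; rewrite /tau ipDr !ipZr !uv // !(mean_dwt _ (u _)) !pu -rtrD -mulmxDl -tens_Dl sumE.
rewrite -(sp1 uV).
by apply: (@rtr_tens_sp 1 m V) => x y; rewrite mul1r tavg_cati.
Qed.

(** Dropping one site out of [1 + m] moves the average marginal by order [1 / m], so it costs little
    purity. *)
Lemma energy_mix t : F 1%N t -> is_marg s t -> ip t t <= ip tau tau + 2 / m%:R.
Proof.
move=> Ft st; have dt := densF (isT : (0 < 1)%N) Ft.
have [V [h [uV et h0]]] := psd_spectral dt.1.
have [w0 w1] := dwt_density uV (densF (isT : (0 < 1 + m)%N) Fs).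
have h1 i : h i <= 1.
  by rewrite -(density_rtr dt) et rtr_sp0 // (bigD1 i) //= lerDl sumr_ge0.
have e : ip t t = (1 + m%:R)^-1 * (mean (dwt V s) (hval h) + m%:R * ip t tau).
  rewrite {1 3}et st // branch_mix // -meanZ -meanD -meanZ.
  by apply: eq_mean => x; exact: davg_head.
have hd : mean (dwt V s) (hval h) <= 1.
  rewrite -[leRHS](mean_cst 1 w1); apply: ler_mean; first exact: w0.
  by move=> x; exact: h1.
have hv b : adj (v b) = v b by apply/psd_herm; case: (densF (isT : (0 < 1)%N) (Fv b)).
have htau : adj tau = tau by rewrite /tau adjD !adjZ !hv.
have y0 : 0 <= ip tau tau by exact: rtr_sqr_ge0.
(* Gives that twice [ip t tau] is at most the sum of the two purities; inserted in [e], it bounds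
   the purity of [t] by that of [tau]. *)
have : 0 <= ip (t - tau) (t - tau) by apply: rtr_sqr_ge0; rewrite adjB htau psd_herm //; case: dt.
rewrite ipBl !ipBr (ipC tau t).
have mR : (0 : R) < m%:R by rewrite ltr0n.
move: mR e hd y0; move: (m%:R : R) (mean _ _) (ip t t) (ip t tau) (ip tau tau) => k A x z y.
move=> k0 e hA y0 hz.
have {}e : (1 + k) * x = A + k * z by rewrite e mulVKf //; apply: lt0r_neq0; lra.
have kz : k * z <= k * ((x + y) / 2) by rewrite ler_pM2l //; lra.
rewrite -(ler_pM2l k0) mulrDr [k * (2 / k)]mulrC mulfVK ?gt_eqF //.
have : (1 + k / 2) * x <= 1 + k / 2 * y by lra.
move=> H; have k2 : 0 < 2 + k by lra.
rewrite -(ler_pM2l k2).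
have : k * ((2 + k) * x) <= k * (2 + k * y) by rewrite ler_pM2l //; lra.
have : 0 <= k * y by rewrite mulr_ge0 // ltW.
by move=> H1 H2; apply: le_trans (_ : k * (2 + k * y) <= _); [lra|]; lra.
Qed.

(** A covariance between the measured site and the other sites separates the expectations of [g] in
    the two branches. Cauchy-Schwarz turns this into a distance between [v false] and [v true], and
    [rtr_convex] into a gain of purity. *)
Lemma energy_branch t (gam c : R) : F 1%N t -> is_marg s t -> 0 <= gam -> (forall i, `|g i| <= c) ->
  gam < cov w (hval g) (davg g) -> c ^+ 2 / m%:R <= gam / 2 ->
  a ^+ 2 * (gam / 2) ^+ 2 <= d%:R * c ^+ 2 * (p false * ip (v false) (v false) +
    p true * ip (v true) (v true) + 2 / m%:R - ip t t).
Proof.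
move=> Ft st gam0 gc hcov hm; set D := d%:R * c ^+ 2.
have [w0 w1] := dwt_density uU (densF (isT : (0 < 1 + m)%N) Fs).
have p01 : p false + p true = 1 by rewrite !branch_prob expr0 expr1; field.
have hv b : adj (v b) = v b by apply/psd_herm; case: (densF (isT : (0 < 1)%N) (Fv b)).
have hB : adj (sp U g : 'M[C]_(d ^ 1)) = sp U g by exact: adj_sp.
have := rtr_CS hB (_ : adj (v false - v true) = v false - v true).
rewrite adjB !hv => /(_ erefl); rewrite ipBr => CS.
have BD : ip (sp U g : 'M[C]_(d ^ 1)) (sp U g) <= D.
  rewrite /ip spM // rtr_sp0 // /D mulr_natl -[X in _ *+ X](card_ord d) -sumr_const.
  apply: ler_sum => i _; rewrite -expr2 -real_normK ?num_real // ler_sqr ?nnegrE //.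
  exact: le_trans (gc i).
have Z0 : 0 <= ip (v false - v true) (v false - v true).
  by apply: rtr_sqr_ge0; rewrite adjB !hv.
have pf : p false = (1 + a * mean w (hval g)) / 2 by rewrite branch_prob expr0 mul1r.
have pt : p true = (1 - a * mean w (hval g)) / 2 by rewrite branch_prob expr1 mulN1r mulNr.
have tf := mean_branch false g; rewrite expr0 mul1r in tf.
have tt := mean_branch true g; rewrite expr1 mulN1r mulNr in tt.
have gain := energy_gain pf pt (p0 false) (p0 true) tf tt (le_trans CS (ler_wpM2r Z0 BD)).
have mix := energy_mix Ft st.
have conv := rtr_convex (v false) (v true) p01; rewrite /= -/tau in conv.
have D0 : 0 <= D by rewrite mulr_ge0 ?sqr_ge0.
(* The average contains the measured site itself, whose variance is at most [c ^+ 2]; by [hm] its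
   share leaves at least half of [gam] for the other sites. *)
have hC : gam / 2 <= cov w (hval g) (tavg g).
  have mR : (0 : R) < m%:R by rewrite ltr0n.
  have m1 : (0 : R) < 1 + m%:R by rewrite addr_gt0.
  have c1 : cov w (hval g) (hval g) <= c ^+ 2.
    apply: (@le_trans _ _ (mean w (fun x => hval g x * hval g x))).
      by rewrite /cov gerBl -expr2 sqr_ge0.
    rewrite -[leRHS](mean_cst _ w1); apply: ler_mean; first exact: w0.
    move=> x; rewrite -expr2 -real_normK ?num_real // ler_sqr ?nnegrE //; first exact: gc.
    exact: le_trans (gc ord0).
  have c2 : cov w (hval g) (davg g) =
      (1 + m%:R)^-1 * (cov w (hval g) (hval g) + m%:R * cov w (hval g) (tavg g)).
    rewrite /cov (eq_mean w (fun z => davg_head g z m0)) meanZ meanD meanZ.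
    rewrite (@eq_mean _ _ w _ (fun z => (1 + m%:R)^-1 *
      (hval g z * hval g z + m%:R * (hval g z * tavg g z)))) ?meanZ ?meanD ?meanZ; first by ring.
    by move=> z; rewrite (davg_head g z m0); ring.
  move: hcov; rewrite c2 mulrC ltr_pdivlMr // => h.
  rewrite ler_pdivrMr // in hm.
  exact: (cov_tail mR h hm c1 gam0).
apply: (@le_trans _ _ (a ^+ 2 * cov w (hval g) (tavg g) ^+ 2)).
  apply: ler_wpM2l; first exact: sqr_ge0.
  have g2 : 0 <= gam / 2 by exact: divr_ge0.
  by rewrite ler_sqr // nnegrE // (le_trans g2 hC).
apply: le_trans gain _; apply: ler_wpM2l => //.
by rewrite conv; exact: mix_sum.
Qed.

(** The combined test measures the first site and then applies the test of the observed branch.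
    Errors under [s] average with weights [p]; under a power of [q] the acceptance probability is a
    convex combination. *)
Lemma branch_test (M : bool -> 'M[C]_(d ^ m)) : (forall i, `|a * g i| <= 1) ->
  (forall b, test (M b)) ->
  exists M', [/\ test M',
    rtr ((1%:M - M') *m s) = p false * rtr ((1%:M - M false) *m u false) +
      p true * rtr ((1%:M - M true) *m u true) &
    forall (q : 'M[C]_d) x, density q -> (forall b, rtr (M b *m ntensmx q m) <= x) ->
      rtr (M' *m ntensmx q (1 + m)) <= x].
Proof.
move=> ag tM.
have pE b : psdmx (E b).
  apply: psd_sp => i; apply: divr_ge0 => //; have := ag i; rewrite ler_norml => /andP[].
  by case: b; rewrite ?expr0 ?expr1 => h1 h2; lra.
exists (tens (E false) (M false) + tens (E true) (M true)).
have eC : 1%:M - (tens (E false) (M false) + tens (E true) (M true)) =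
    tens (E false) (1%:M - M false) + tens (E true) (1%:M - M true).
  exact: (tens_compl _ _ sumE).
split.
- split; first by apply: psdD; apply: psd_tens; [exact: pE|exact: (tM _).1|exact: pE|exact: (tM _).1].
  by rewrite eC; apply: psdD; apply: psd_tens; [exact: pE|exact: (tM _).2|exact: pE|exact: (tM _).2].
- rewrite eC (mulmxDl (tens (E false) _)) rtrD. by rewrite (pu false) (pu true).
- move=> q x dq hx; rewrite (ntensS q m) mulmxDl rtrD !tensM.
  have rt b : rtr (tens (E b *m (q : 'M[C]_(d ^ 1))) (M b *m ntensmx q m)) =
      rtr (E b *m (q : 'M[C]_(d ^ 1))) * rtr (M b *m ntensmx q m).
    rewrite /rtr tr_tens (tr_hermM (psd_herm (pE b)) (psd_herm dq.1)).
    exact: ReZ.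
  have e0 b : 0 <= rtr (E b *m (q : 'M[C]_(d ^ 1))) by apply: rtr_psdM_ge0 => //; case: dq.
  rewrite !rt; apply: (@le_trans _ _ (rtr (E false *m (q : 'M[C]_(d ^ 1))) * x + rtr (E true *m (q : 'M[C]_(d ^ 1))) * x)).
    by apply: lerD; apply: ler_wpM2l.
  by rewrite -mulrDl -rtrD -mulmxDl sumE mul1mx density_rtr // mul1r.
Qed.

End Step.

(** * Iterating the conditioning step *)

Lemma davg_pidx n (pi : 'S_n) g (x : 'I_(d ^ n)) : davg g (pidx pi x) = davg g x :> R.
Proof.
rewrite /davg; congr (_ * _); rewrite [RHS](reindex_inj (@perm_inj _ pi)).
by apply: eq_bigr => k _; rewrite dig_pidx.
Qed.

Lemma energy_step m (s : 'M[C]_(d ^ (1 + m))) t (U : 'M[C]_d) (g : 'I_d -> R) (c gam kap : R) :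
  (0 < m)%N -> F (1 + m)%N s -> F 1%N t -> is_marg s t -> unit_mx U -> 0 < c ->
  (forall i, `|g i| <= c) -> 0 <= gam -> gam < cov (dwt U s) (davg g) (davg g) ->
  c ^+ 2 / m%:R <= gam / 2 -> 2 / m%:R <= kap ->
  kap *+ 2 <= (r 1%N / c) ^+ 2 * (gam / 2) ^+ 2 / (d%:R * c ^+ 2) ->
  exists (p : bool -> R) (u : bool -> 'M[C]_(d ^ m)) (v : bool -> 'M[C]_(d ^ 1)),
  [/\ forall b, 0 <= p b, p false + p true = 1,
      forall b, [/\ F m (u b), F 1%N (v b) & is_marg (u b) (v b)],
      ip t t + kap <= p false * ip (v false) (v false) + p true * ip (v true) (v true) &
      forall M : bool -> 'M[C]_(d ^ m), (forall b, test (M b)) ->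
      exists M', [/\ test M',
        rtr ((1%:M - M') *m s) = p false * rtr ((1%:M - M false) *m u false) +
          p true * rtr ((1%:M - M true) *m u true) &
        forall (q : 'M[C]_d) x, density q -> (forall b, rtr (M b *m ntensmx q m) <= x) ->
          rtr (M' *m ntensmx q (1 + m)) <= x]].
Proof.
move=> m0 Fs Ft st uU c0 gc gam0 hcov hm1 hm2 hk.
have [k hck] := site_cov (isT : (0 < 1 + m)%N) hcov.
pose pi := tperm k (lshift m (ord0 : 'I_1)).
pose P := perm_op R d pi; pose s' := P *m s *m adj P.
have Fs' : F (1 + m)%N s' by exact: permF.
have st' : is_marg s' t by exact: is_marg_perm.
have hcov' : gam < cov (dwt U s') (hval g) (davg g).
  suff -> : cov (dwt U s') (hval g) (davg g) =
      cov (dwt U s) (fun x => g (dig x k)) (davg g) by [].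
  have hv x : hval g x = g (dig (pidx pi x) k) by rewrite dig_pidx tpermL.
  have hd x : davg g x = davg g (pidx pi x) by rewrite davg_pidx.
  have mp f f' : (forall x, f x = f' (pidx pi x)) -> mean (dwt U s') f = mean (dwt U s) f'.
    exact: mean_perm.
  rewrite /cov (mp (hval g) (fun x => g (dig x k)) hv) (mp (davg g) (davg g) hd).
  congr (_ - _); apply: (mp _ (fun x => g (dig x k) * davg g x)) => x.
  by rewrite hv hd.
have /andP[r0 r1] := r01 (isT : (0 < 1)%N).
(* The scaling brings the measured observable within the norm allowed by compatibility. *)
pose a := r 1%N / c.
have ag i : `|a * g i| <= r 1%N.
  rewrite normrM ger0_norm ?divr_ge0 ?(ltW r0) ?(ltW c0) //.
  by rewrite /a mulrAC ler_pdivrMr // ler_pM2l.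
have H b : exists pu : R * 'M[C]_(d ^ m), [/\ 0 <= pu.1, F m pu.2 &
    forall B, pu.1 * rtr (B *m pu.2) = rtr (tens (sp U (fun i => effect b (a * g i)) : 'M[C]_(d ^ 1)) B *m s')].
  have [l [u [l0 Fu uE]]] := @cond_state 1 m U (fun i => a * g i) b s' isT m0 uU ag Fs'.
  by exists (l, u).
have [pu hpu] := choice H.
have H2 b : exists v : 'M[C]_(d ^ 1), F 1%N v /\ is_marg (pu b).2 v.
  by case: (hpu b) => _ Fu _; have [v Fv vE] := marg_state m0 Fu; exists v.
have [v hv] := choice H2.
pose p b := (pu b).1; pose u b := (pu b).2.
have p0 b : 0 <= p b by case: (hpu b).
have Fu b : F m (u b) by case: (hpu b).
have Fv b : F 1%N (v b) := (hv b).1.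
have uv b : is_marg (u b) (v b) := (hv b).2.
have puE b B : p b * rtr (B *m u b) = rtr (tens (sp U (fun i => effect b (a * g i)) : 'M[C]_(d ^ 1)) B *m s').
  by case: (hpu b).
exists p, u, v; split => //.
- by rewrite !(branch_prob m0 Fs' uU Fu puE) expr0 expr1; field.
- have D0 : 0 < d%:R * c ^+ 2 by rewrite mulr_gt0 ?exprn_gt0 ?ltr0n.
  have := energy_branch m0 Fs' uU p0 Fu Fv uv puE Ft st' gam0 gc hcov' hm1.
  rewrite [leRHS]mulrC -ler_pdivrMr // => h.
  exact: (energy_sum (le_trans hk h) hm2).
- move=> M tM.
  have ag1 i : `|a * g i| <= 1 by exact: le_trans (ag i) r1.
  have [M' [tM' eM' hM']] := branch_test uU puE ag1 tM.
  have uP : unit_mx P by exact: unit_perm.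
  (* The test for the permuted state is conjugated back; powers of a one-site state do not see the
     permutation. *)
  exists (adj P *m M' *m P); split.
  + have tP : test (adj P *m P) by rewrite (unit_mxV uP); exact: test1.
    exact: testJ tP tM'.
  + rewrite -eM' /s'.
    have -> : 1%:M - adj P *m M' *m P = adj P *m (1%:M - M') *m P.
      by rewrite mulmxBr mulmx1 mulmxBl (unit_mxV uP).
    exact: rtr_conjC.
  + move=> q x dq hq; apply: le_trans (hM' q x dq hq).
    by rewrite rtr_conjC /P permJ_ntens.
Qed.

Definition has_test n (rho : 'M[C]_d) (s : 'M[C]_(d ^ n)) (err beta : R) :=
  exists M, [/\ test M, rtr ((1%:M - M) *m s) <= err & rtr (M *m ntensmx rho n) <= beta].

(* Each conditioning step that does not end with concentrated empirical averages raises the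
   purity of the average marginal by [kap]; the purity is at most 1, so the bound on the error
   improves by [e * kap] per available step. *)
Lemma test_induction (rho : 'M[C]_d) (c gam kap e0 e L : R) n0 :
  density rho -> (0 < n0)%N -> 0 < c -> 0 <= gam -> 0 <= L -> 0 <= e0 -> 0 <= e ->
  (forall n s t, (n0 <= n)%N -> F n s -> F 1%N t -> is_marg s t ->
    (forall (U : 'M[C]_d) g, unit_mx U -> (forall i, `|g i| <= c) ->
      cov (dwt U s) (davg g) (davg g) <= gam) ->
    has_test rho s e0 (expR (- (n%:R * L)))) ->
  (forall n, (n0 <= n)%N -> c ^+ 2 / n%:R <= gam / 2 /\ 2 / n%:R <= kap) ->
  kap *+ 2 <= (r 1%N / c) ^+ 2 * (gam / 2) ^+ 2 / (d%:R * c ^+ 2) ->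
  forall k m s t, k%:R * (e * kap) <= 1 -> (n0 <= m)%N -> F (k + m)%N s -> F 1%N t -> is_marg s t ->
  has_test rho s (e0 + 1 + e * (1 - ip t t) - k%:R * (e * kap)) (expR (- (m%:R * L))).
Proof.
move=> drho n00 c0 gam0 L0 e00 e1 good hn hk.
have it1 t : F 1%N t -> ip t t <= 1 by move=> Ft; apply: rtr_density_sqr; exact: densF Ft.
elim=> [|k IH] m s t hke hm Fs Ft st.
  (* With no step left the error bound is at least 1, so rejecting always is admissible. *)
  exists 0; split.
  - by split; [exact: psd0|rewrite subr0; exact: psd1].
  - rewrite subr0 mul1mx density_rtr; last by apply: densF Fs; exact: leq_trans hm.
    rewrite mul0r subr0; have : 0 <= e * (1 - ip t t) by rewrite mulr_ge0 // subr_ge0 it1.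
    by move: e00; move: (e * _) => y h1 h2; lra.
  - by rewrite mul0mx /rtr mxtrace0 expR_ge0.
have m1 : (0 < k + m)%N by rewrite addn_gt0 (leq_trans n00 hm) orbT.
have nm : (n0 <= k + m)%N by exact: leq_trans hm (leq_addl _ _).
have [conc|/existsNP[U /existsNP[g /not_implyP[uU /not_implyP[gc /negP]]]]] :=
    pselect (forall (U : 'M[C]_d) g, unit_mx U -> (forall i, `|g i| <= c) ->
      cov (dwt U s) (davg g) (davg g) <= gam).
  have [M [tM err beta]] := good _ _ _ (leq_trans nm (leqnSn _)) Fs Ft st conc.
  exists M; split=> //.
    (* The subtracted term is at most 1 by [hke], so it is covered by the constant 1 in the
       bound. *)
    apply: le_trans err _; have : 0 <= e * (1 - ip t t) by rewrite mulr_ge0 // subr_ge0 it1.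
    by move: hke; move: (e * (1 - _)) (k.+1%:R * _) => x y h1 h2; lra.
  apply: le_trans beta _; rewrite ler_expR lerN2; apply: ler_wpM2r => //.
  by rewrite ler_nat; exact: leq_addl k.+1 m.
rewrite -ltNge => hcov.
have [h1 h2] := hn _ nm.
have [p [u [v [p0 p1 uvF gain hM]]]] := energy_step m1 Fs Ft st uU c0 gc gam0 hcov h1 h2 hk.
have hke' : k%:R * (e * kap) <= 1.
  apply: le_trans hke; apply: ler_wpM2r; last by rewrite ler_nat.
  apply: mulr_ge0 => //; case: (hn _ nm) => _; apply: le_trans.
  by rewrite divr_ge0.
have H b : has_test rho (u b) (e0 + 1 + e * (1 - ip (v b) (v b)) - k%:R * (e * kap)) (expR (- (m%:R * L))).
  by have [Fu Fv uv] := uvF b; apply: IH.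
have [M HM] := choice H.
have [M' [tM' err beta]] := hM M (fun b => let: And3 h _ _ := HM b in h).
exists M'; split => //; last by apply: beta => // b; case: (HM b).
rewrite err -natr1.
have E b : p b * rtr ((1%:M - M b) *m u b) <=
    p b * (e0 + 1 + e * (1 - ip (v b) (v b)) - k%:R * (e * kap)).
  by apply: ler_wpM2l => //; case: (HM b).
apply: le_trans (lerD (E false) (E true)) _.
exact: err_sum.
Qed.

(** The constant [c] bounds the regularized logarithms of all states at once, so one concentration
    hypothesis covers the eigenbasis of [t] and that of the second state. The exponent is then the
    regularized divergence of [t]. *)
Lemma concentrated_test (U : 'M[C]_d) (mu : 'I_d -> R) (e de L gam : R) n
    (s : 'M[C]_(d ^ n)) t :
  unit_mx U -> (forall i, 0 <= mu i <= 1) -> 0 < e -> 0 < de -> (0 < n)%N ->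
  (forall t V lam, F 1%N t -> unit_mx V -> t = sp V lam ->
    L + 2 * de <= mean lam (fun i => ln (reg d' e (lam i))) - mean (wt U t) (fun i => ln (mu i + e))) ->
  F n s -> F 1%N t -> is_marg s t ->
  let c := 1 + (`|ln (reg d' e 0)| + `|ln (reg d' e 1)|) + (`|ln e| + `|ln (1 + e)|) in
  (forall (V : 'M[C]_d) g, unit_mx V -> (forall i, `|g i| <= c) ->
    cov (dwt V s) (davg g) (davg g) <= gam) ->
  has_test (sp U mu) s (5 * gam / de ^+ 2) (expR (- (n%:R * L))).
Proof.
move=> uU mu01 e0 de0 n0 hL Fs Ft st c conc.
have dt := densF (isT : (0 < 1)%N) Ft.
have [V [lam [uV et l0]]] := psd_spectral dt.1.
have [_ l1 lle] := eig_density dt uV et.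
pose g1 i := ln (reg d' e (lam i)); pose g2 i := ln (mu i + e).
have D0 : 0 < 1 + d%:R * e by exact: den_gt0.
have hg1 i : `|g1 i| <= c.
  apply: (@le_trans _ _ (`|ln (reg d' e 0)| + `|ln (reg d' e 1)|)).
    apply: abs_ln_le; first exact: reg_gt0.
      by rewrite /reg ler_pM2r ?invr_gt0 // lerD2r.
    by rewrite /reg ler_pM2r ?invr_gt0 // lerD2r.
  by apply: one_add_gel; rewrite addr_ge0.
have hg2 i : `|g2 i| <= c.
  apply: (@le_trans _ _ (`|ln e| + `|ln (1 + e)|)).
    have /andP[m0 m1] := mu01 i.
    by apply: abs_ln_le => //; rewrite ?lerDr ?lerD2r.
  by apply: one_add_ger; rewrite addr_ge0.
have hmu i : 0 <= mu i <= expR (g2 i).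
  have /andP[m0 m1] := mu01 i.
  by rewrite m0 lnK ?posrE ?ltr_wpDl // lerDl ltW.
have hs1 : \sum_i expR (g1 i) <= 1.
  rewrite -(sum_reg e0 l1); apply: ler_sum => i _.
  by rewrite lnK // posrE reg_gt0.
have [M [tM err beta]] := typical_test n0 (densF n0 Fs) uU uV de0 (conc V g1 uV hg1)
  (conc U g2 uU hg2) hmu hs1.
exists M; split => //; apply: le_trans beta _; rewrite ler_expR -mulrN ler_pM2l ?ltr0n //.
rewrite -(st V g1 uV) -(st U g2 uU) /ip !rtr_sp_mul.
have := hL t V lam Ft uV et.
have <- : mean (wt V t) g1 = mean lam g1.
  by apply: eq_bigr => i _; rewrite et wt_sp.
rewrite /mean; move: (\sum_x _) (\sum_x _) => x y h; lra.
Qed.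

Lemma lower_tests (U : 'M[C]_d) (mu : 'I_d -> R) (e de L eps : R) :
  unit_mx U -> density (sp U mu) -> 0 < e -> 0 < de -> 0 <= L -> 0 < eps ->
  (forall t V lam, F 1%N t -> unit_mx V -> t = sp V lam ->
    L + 2 * de <= mean lam (fun i => ln (reg d' e (lam i))) - mean (wt U t) (fun i => ln (mu i + e))) ->
  exists K n1 : nat, forall m, (n1 <= m)%N -> forall s : 'M[C]_(d ^ (K + m)), F (K + m)%N s ->
    has_test (sp U mu) s eps (expR (- (m%:R * L))).
Proof.
move=> uU dr e0 de0 L0 eps0 hL.
have [m0 _ m1] := eig_density dr uU erefl.
have mu01 i : 0 <= mu i <= 1 by rewrite m0 m1.
pose c := 1 + (`|ln (reg d' e 0)| + `|ln (reg d' e 1)|) + (`|ln e| + `|ln (1 + e)|).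
have c0 : 0 < c by rewrite ltr_pwDl // ?ltr_pwDl // addr_ge0.
(* Chosen so that the error of the concentrated test is one third of [eps]. *)
pose gam := eps / 3 * de ^+ 2 / 5.
have gam0 : 0 < gam by apply: divr_gt0 => //; apply: mulr_gt0; [exact: divr_gt0|exact: exprn_gt0].
have gamE : 5 * gam / de ^+ 2 = eps / 3 by rewrite /gam; field; rewrite gt_eqF.
have /andP[r0 _] := r01 (isT : (0 < 1)%N).
have D0 : 0 < d%:R * c ^+ 2 by rewrite mulr_gt0 ?ltr0n // exprn_gt0.
(* Half of the guaranteed gain; the other half pays for the loss [2 / n%:R] caused by dropping a
   site. *)
have [kap kap0 hk] : exists2 kap : R, 0 < kap &
    kap *+ 2 <= (r 1%N / c) ^+ 2 * (gam / 2) ^+ 2 / (d%:R * c ^+ 2).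
  exists ((r 1%N / c) ^+ 2 * (gam / 2) ^+ 2 / (d%:R * c ^+ 2) / 2).
    have rc : 0 < r 1%N / c by exact: divr_gt0.
    have g2 : 0 < gam / 2 by exact: divr_gt0.
    by apply: divr_gt0 => //; apply: divr_gt0 => //; apply: mulr_gt0; exact: exprn_gt0.
  by rewrite mulr2n -splitr.
(* With [b] below, [K] steps cancel the constant 1 in the error bound exactly, while [b] itself is
   at most [eps / 3]. *)
pose K := (Num.bound (3 / (eps * kap))).+1.
have KR : (0 : R) < K%:R by rewrite ltr0n.
pose b := (K%:R * kap)^-1.
have b0 : 0 < b by rewrite invr_gt0 mulr_gt0.
have Kb : K%:R * (b * kap) = 1 by rewrite /b; field; rewrite !gt_eqF.
have bE : b <= eps / 3.
  have h0 : 0 <= 3 / (eps * kap) by rewrite divr_ge0 // mulr_ge0 // ltW.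
  have := archi_boundP h0; rewrite ltr_pdivrMr ?mulr_gt0 // => h.
  have h2 : 3 <= K%:R * (eps * kap).
    apply: le_trans (ltW h) _; apply: ler_wpM2r; first by rewrite mulr_ge0 // ltW.
    by rewrite ler_nat leqnSn.
  rewrite /b -div1r ler_pdivrMr ?mulr_gt0 //.
  by rewrite (_ : eps / 3 * (K%:R * kap) = K%:R * (eps * kap) / 3) ?ler_pdivlMr ?mul1r //; field.
pose x0 := c ^+ 2 / (gam / 2) + 2 / kap.
have x00 : 0 <= x0 by rewrite addr_ge0 // divr_ge0 ?sqr_ge0 // ltW // divr_gt0.
pose n0 := (Num.bound x0).+1.
have hn n : (n0 <= n)%N -> c ^+ 2 / n%:R <= gam / 2 /\ 2 / n%:R <= kap.
  move=> hn; have nR : (0 : R) < n%:R by rewrite ltr0n; exact: leq_trans hn.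
  have xn : x0 <= n%:R.
    apply: le_trans (ltW (archi_boundP x00)) _; rewrite ler_nat.
    exact: leq_trans (leqnSn _) hn.
  have gg : 0 < gam / 2 by exact: divr_gt0.
  split; rewrite ler_pdivrMr // [leRHS]mulrC -ler_pdivrMr //.
    by apply: le_trans xn; rewrite lerDl divr_ge0 // ltW.
  by apply: le_trans xn; rewrite lerDr divr_ge0 ?sqr_ge0 // ltW.
exists K, n0 => m hm s Fs.
have [t Ft st] := marg_state (ltn_addr m (isT : (0 < K)%N)) Fs.
have e3 : 0 <= eps / 3 by rewrite ltW // divr_gt0.
have hK : K%:R * (b * kap) <= 1 by rewrite Kb.
have good n (s1 : 'M[C]_(d ^ n)) t1 : (n0 <= n)%N -> F n s1 -> F 1%N t1 -> is_marg s1 t1 ->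
    (forall (V : 'M[C]_d) g, unit_mx V -> (forall i, `|g i| <= c) ->
      cov (dwt V s1) (davg g) (davg g) <= gam) ->
    has_test (sp U mu) s1 (eps / 3) (expR (- (n%:R * L))).
  move=> hn1 Fs1 Ft1 st1 conc; rewrite -gamE.
  exact: (concentrated_test uU mu01 e0 de0 (leq_trans (ltn0Sn _) hn1) hL Fs1 Ft1 st1 conc).
have [M [tM err beta]] := test_induction dr (ltn0Sn _) c0 (ltW gam0) L0 e3 (ltW b0) good hn hk hK hm Fs Ft st.
exists M; split => //; apply: le_trans err _; rewrite Kb.
have t0 : 0 <= ip t t.
  by apply: rtr_sqr_ge0; apply: psd_herm; case: (densF (isT : (0 < 1)%N) Ft).
have : b * (1 - ip t t) <= b by rewrite -[leRHS]mulr1 ler_pM2l // gerBl.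
by move: bE e3; move: (b * _) => y h1 h2 h3; lra.
Qed.

(** * From tests to asymptotic rates *)

Lemma rate_ge (rho : 'M[C]_d) eps n (L : R) : (0 < n)%N ->
  (forall s, F n s -> ((n%:R * L)%:E <= DH eps s (tpow rho n))%E) ->
  (L%:E <= rate F rho eps n)%E.
Proof.
move=> n0 h; have nR : (n%:R : R) != 0 by rewrite pnatr_eq0 -lt0n.
have -> : L%:E = ((n%:R^-1)%:E * (n%:R * L)%:E)%E by rewrite -EFinM mulKf.
rewrite /rate; apply: lee_wpmul2l; first by rewrite lee_fin invr_ge0.
by apply: le_ereal_inf_tmp => _ [s Fs <-]; exact: h.
Qed.

Lemma rate_le (rho : 'M[C]_d) eps n s (L : R) : (0 < n)%N -> F n s ->
  (DH eps s (tpow rho n) <= (n%:R * L)%:E)%E -> (rate F rho eps n <= L%:E)%E.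
Proof.
move=> n0 Fs h; have nR : (n%:R : R) != 0 by rewrite pnatr_eq0 -lt0n.
have -> : L%:E = ((n%:R^-1)%:E * (n%:R * L)%:E)%E by rewrite -EFinM mulKf.
rewrite /rate; apply: lee_wpmul2l; first by rewrite lee_fin invr_ge0.
by apply: le_trans h; apply: ereal_inf_lbound; exists s.
Qed.

Lemma rate_upper (rho : 'M[C]_d) eps (s : 'M[C]_(d ^ 1)) (a : R) :
  density rho -> 0 < eps < 1 -> density s -> (forall n, (0 < n)%N -> F n (tpow s n)) ->
  (relent (s : 'M[C]_d) rho < a%:E)%E ->
  \forall n \near \oo, (rate F rho eps n <= a%:E)%E.
Proof.
move=> dr /andP[eps0 eps1] ds Fs; rewrite (relentE ds.1 dr.1).
have [uV es _] := herm_spectral (psd_herm ds.1).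
have [uU er _] := herm_spectral (psd_herm dr.1).
move: (spectralmx (s : 'M[C]_d)) (eig (s : 'M[C]_d)) uV es => V lam uV es.
move: (spectralmx rho) (eig rho) uU er => U mu uU er.
case: ifP => // /asboolP supp; set A := _ - _; rewrite lte_fin => Aa.
have [m0 _ _] := eig_density dr uU er.
have de0 : 0 < (a - A) / 4 by rewrite divr_gt0 // subr_gt0.
have ds' := ds; rewrite es in ds' supp.
have [K hK] := product_converse uU uV ds' m0 supp de0.
(* The acceptance probability under [s] is at least [4 * c]; [K / n%:R] takes at most [2 * c], and
   the factor 2 of the converse leaves [c]. *)
pose c := (1 - eps) / 4; have c0 : 0 < c by rewrite divr_gt0 // subr_gt0.
pose x0 := `|K| / (2 * c) + 2 * `|ln c| / (a - A).
have aA : 0 < a - A by rewrite subr_gt0.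
have c2 : 0 < 2 * c by exact: mulr_gt0.
have x00 : 0 <= x0.
  by apply: addr_ge0; apply: divr_ge0; [| exact: ltW |exact: mulr_ge0|exact: ltW].
apply: (@near_nat_ge (Num.bound x0).+1) => n hn.
have n0 : (0 < n)%N by exact: leq_trans hn.
have nR : (0 : R) < n%:R by rewrite ltr0n.
have xn : x0 <= n%:R.
  apply: le_trans (ltW (archi_boundP x00)) _; rewrite ler_nat.
  exact: leq_trans (leqnSn _) hn.
have Kn : K / n%:R <= 2 * c.
  rewrite ler_pdivrMr // mulrC -ler_pdivrMr //.
  apply: le_trans xn; apply: (@le_trans _ _ (`|K| / (2 * c))).
    by rewrite ler_pM2r ?ler_norm // invr_gt0.
  by rewrite lerDl divr_ge0 ?mulr_ge0 // ltW.
have lnc : - ln c <= n%:R * ((a - A) / 2).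
  have : 2 * `|ln c| / (a - A) <= n%:R.
    by apply: le_trans xn; rewrite lerDr divr_ge0 // ltW.
  rewrite ler_pdivrMr // => h; have := ler_norm (- ln c); rewrite normrN => h2.
  by move: h h2; rewrite mulrA; move: (n%:R * _) `|_| => y z h h2; lra.
apply: (rate_le n0 (Fs n n0)); apply: DH_le; apply: hyptest_ge; first exact: ltW.
move=> M tM hM.
have h1 : 1 - eps <= rtr (M *m tpow s n).
  have : rtr ((1%:M - M) *m tpow s n) = 1 - rtr (M *m tpow s n).
    by rewrite mulmxBl mul1mx rtrB density_tpow.
  by move=> e; move: hM; rewrite e; lra.
have h2 := hK n n0 M tM; rewrite -es -er -/A in h2.
have h3 : 4 * c <= 2 * expR (n%:R * (A + 2 * ((a - A) / 4))) * rtr (M *m tpow rho n) + 2 * c.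
  by apply: le_trans (le_trans (_ : _ <= 1 - eps) (le_trans h1 (le_trans h2 _))) _;
    rewrite ?lerD2l // /c; lra.
have h4 : c <= expR (n%:R * (A + 2 * ((a - A) / 4))) * rtr (M *m tpow rho n).
  by move: h3; rewrite -mulrA; move: (expR _ * _) => y h; lra.
have h5 : expR (- (n%:R * (A + 2 * ((a - A) / 4)))) * c <= rtr (M *m tpow rho n).
  by rewrite expRN mulrC ler_pdivrMr ?expR_gt0 // mulrC.
apply: le_trans h5; rewrite -[c in leRHS]lnK ?posrE // -expRD ler_expR.
have -> : A + 2 * ((a - A) / 4) = a - (a - A) / 2 by lra.
by move: lnc; rewrite mulrBr; move: (n%:R * a) (n%:R * _) (ln c) => x y z h; lra.
Qed.

Lemma tpow_mem (s : 'M[C]_(d ^ 1)) n : F 1%N s -> (0 < n)%N -> F n (tpow (s : 'M[C]_d) n).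
Proof.
move=> Fs; elim: n => // -[|n] IH _; first exact: Fs.
rewrite -[n.+2]/(1 + n.+1)%N /tpow ntensS; apply: tensF => //.
exact: IH.
Qed.

Lemma rate_lower (rho : 'M[C]_d) eps (a : R) :
  density rho -> 0 < eps < 1 -> (a%:E < relent_set (F 1%N) rho)%E ->
  \forall n \near \oo, (a%:E <= rate F rho eps n)%E.
Proof.
move=> dr /andP[eps0 eps1] aD; have e0 := ltW eps0.
(* A negative threshold is met by the test that always accepts. *)
case: (ltrP a 0) => [a0|a0].
  apply: (@near_nat_ge 1) => n n0; apply: rate_ge => // s Fs; apply: DH_ge => //.
    exact: psd_tpow dr.1.
  apply: (@le_trans _ _ (rtr (1%:M *m tpow rho n))).
    apply: hyptest_le; [exact: psd_tpow dr.1|exact: test1|].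
    by rewrite subrr mul0mx /rtr mxtrace0.
  rewrite mul1mx density_tpow // -[leLHS]expR0 ler_expR oppr_ge0.
  by apply: mulr_ge0_le0; [exact: ler0n|exact: ltW].
have [b ab bD] : exists2 b : R, a < b & (b%:E < relent_set (F 1%N) rho)%E.
  case: (relent_set (F 1%N) rho) aD => [x| |] //= h.
    by exists ((a + x) / 2); rewrite ?lte_fin; move: h; rewrite lte_fin => h; lra.
  by exists (a + 1); rewrite ?ltrDl // ltry.
have [uU er _] := herm_spectral (psd_herm dr.1).
have relE := fun (s : 'M[C]_d) (ps : psdmx s) => relentE ps dr.1.
move: (spectralmx rho) (eig rho) uU er relE => U mu uU er relE.
have [m0 _ m1] := eig_density dr uU er.
have mu01 i : 0 <= mu i <= 1 by rewrite m0 m1.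
have [|e /andP[ep _] hreg] := regularized_bound (densF (isT : (0 < 1)%N)) closedF uU mu01 (L := b).
  move=> t Ft supp; have dt := densF (isT : (0 < 1)%N) Ft.
  have : (b%:E < relent (t : 'M[C]_d) rho)%E.
    by apply: lt_le_trans bD _; apply: ereal_inf_lbound; exists t.
  by rewrite (relE t dt.1); case: ifP => [_|/asboolP //]; rewrite lte_fin.
pose de := (b - a) / 4; have de0 : 0 < de by rewrite divr_gt0 // subr_gt0.
(* Half of the gap between [a] and [b] goes to the test estimates. The other half, [L - a],
   compensates the at most [K] sites lost to conditioning once [n] exceeds [x0]. *)
pose L := a + 2 * de; have L0 : 0 <= L by rewrite addr_ge0 // mulr_ge0 // ltW.
have Lb : L + 2 * de = b by rewrite /L /de; field.
have hreg' t V lam : F 1%N t -> unit_mx V -> t = sp V lam ->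
    L + 2 * de <= mean lam (fun i => ln (reg d' e (lam i))) - mean (wt U t) (fun i => ln (mu i + e)).
  by rewrite Lb; exact: hreg.
rewrite er in dr.
have [K [n1 hK]] := lower_tests uU dr ep de0 L0 eps0 hreg'.
pose x0 := K%:R * L / (L - a).
have La : 0 < L - a by rewrite /L addrC addKr mulr_gt0.
have x00 : 0 <= x0 by rewrite divr_ge0 ?mulr_ge0 // ltW.
apply: (@near_nat_ge (K + n1 + (Num.bound x0).+1)) => n hn.
have n0 : (0 < n)%N by apply: leq_trans hn; rewrite addnS.
have Kn : (K <= n)%N by apply: leq_trans hn; rewrite -addnA leq_addr.
have xn : x0 <= n%:R.
  apply: le_trans (ltW (archi_boundP x00)) _; rewrite ler_nat.
  by apply: leq_trans hn; rewrite addnS leqW // leq_addl.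
have nE : n = (K + (n - K))%N by rewrite subnKC.
have n1m : (n1 <= n - K)%N by rewrite leq_subRL // (leq_trans _ hn) // leq_addr.
move: (n - K)%N nE n1m => m nE n1m; subst n.
apply: rate_ge => // s Fs.
have [M [tM err beta]] := hK m n1m s Fs.
have pr : psdmx (tpow rho (K + m)) by apply: psd_tpow; rewrite er; case: dr.
apply: DH_ge => //; apply: le_trans (hyptest_le pr tM err) _.
rewrite /tpow er; apply: le_trans beta _; rewrite ler_expR lerN2.
move: xn; rewrite /x0 ler_pdivrMr // natrD.
by rewrite mulrBr !mulrDl; move: (K%:R * L) (m%:R * L) (K%:R * a) (m%:R * a) => x y z w h; lra.
Qed.

Lemma sanov (rho : 'M[C]_d) : density rho ->
  (forall eps : R, 0 < eps < 1 ->
     rate F rho eps n @[n --> \oo] --> relent_set (F 1%N) rho)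
  /\ Sanov F rho = relent_set (F 1%N) rho.
Proof.
move=> dr.
have H eps : 0 < eps < 1 -> rate F rho eps n @[n --> \oo] --> relent_set (F 1%N) rho.
  move=> he; apply: ereal_cvg_squeeze => a h; first exact: rate_lower.
  have [_ [s Fs <-] sa] := ereal_inf_lt h.
  have ds : density s := densF (isT : (0 < 1)%N) Fs.
  apply: (rate_upper dr he ds) sa => n n0; exact: tpow_mem.
split => //; apply: cvg_lim => //.
(* The inner limit has the same value for every [eps] in (0, 1), so the outer one is that of a
   constant near 0. *)
apply: (@cvg_trans _ (cst (relent_set (F 1%N) rho) @ (0 : R)^'+)); last exact: cvg_cst.
apply: near_eq_cvg; near=> eps => /=.
have he : 0 < eps < 1 by apply/andP; split; near: eps; [exact: nbhs_right_gt|exact: nbhs_right_lt].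
by have [-> _] := cvg_limn_einf_sup (H eps he).
Unshelve. all: by end_near.
Qed.

End Conditioning.

Unset Implicit Arguments.

Theorem mainTheorem5 (R : realType) (d : nat)
  (F : forall n : nat, set 'M[R[i]]_(d ^ n)) (r : nat -> R) :
  (* (1) convex and closed *)
  (forall n, (0 < n)%N -> mx_convex (F n) /\ mx_closed (F n)) ->
  (* F_n consists of states *)
  (forall n, (0 < n)%N -> forall s, F n s -> density s) ->
  (* (2) F_1 contains a full-rank state *)
  (exists2 s, F 1%N s & full_rank s) ->
  (* (3) closed under tracing out the last subsystem *)
  (forall n, (0 < n)%N -> forall s, F n.+1 s -> F n (trace_last s)) ->
  (* (4) closed under tensor products *)
  (forall n m, (0 < n)%N -> (0 < m)%N -> forall s s',
     F n s -> F m s' -> F (n + m)%N (tens s s')) ->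
  (* (5) permutation invariance *)
  (forall n, (0 < n)%N -> forall (pi : 'S_n) s,
     F n s -> F n (perm_op R d pi *m s *m adj (perm_op R d pi))) ->
  (* r_n in (0,1] *)
  (forall n, (0 < n)%N -> 0 < r n <= 1) ->
  (* compatibility condition *)
  (forall n m, (0 < n)%N -> (0 < m)%N ->
     forall X : 'M[R[i]]_(d ^ n), X \is hermsymmx -> opnorm X <= r n ->
     forall (b : bool) (s : 'M[R[i]]_(d ^ (n + m))), F (n + m)%N s ->
       mx_cone (F m)
         (@trace_firsts R d n m
            (tens ((2 : R[i])^-1 *: (1%:M + (-1) ^+ b *: X))
                  (1%:M : 'M[R[i]]_(d ^ m)) *m s))) ->
  forall rho : 'M[R[i]]_d, density rho ->
  (forall eps : R, 0 < eps < 1 ->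
     rate F rho eps n @[n --> \oo] --> relent_set (F 1%N) rho)
  /\ Sanov F rho = relent_set (F 1%N) rho.
Proof.
move=> conv_closed dens _ _ tensF permF r01 compat rho drho.
(* In dimension 0 every trace vanishes, so there is no state [rho]. *)
have d0 : (0 < d)%N.
  by case: d F rho drho {conv_closed dens tensF permF compat} => // F rho /density_rtr;
    rewrite /rtr /mxtrace big_ord0 /= => /eqP; rewrite eq_sym oner_eq0.
case: d d0 F conv_closed dens tensF permF compat rho drho => // d' _ F conv_closed dens tensF permF compat rho drho.
have [convF closedF] := conv_closed 1%N isT.
exact: (@sanov R d' F r convF closedF dens tensF permF r01 compat rho drho).
Qed.
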